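(* Let $N=2n\geq4$ be even, $\omega=\exp(2\pi i/N)$, let $u\in\mathbb{C}$ with $u\neq0$, $u^N\neq1$, and let $A$, $e_a$, $\ell$ be as in the context. The center of $A$ is $\mathbb{C}$. With $C_{a,b}=\dim_{\mathbb{C}}e_aAe_b$ for $a,b\in\mathbb{Z}/N\mathbb{Z}$, the Cartan matrix of $A$ is $$C_{a,b}=\begin{cases}1,&a=b\text{ or }\ell(a)\neq\ell(b),\\ 0,&a\neq b\text{ and }\ell(a)=\ell(b).\end{cases}$$ It has rank $N-1$ and kernel spanned by $\delta_0-\delta_n$, where $\delta_a$ is the coordinate vector indexed by $a$. Consequently $\operatorname{gldim}A=\infty$, and $A$ has infinite representation type. In fact, $A$ has a quotient isomorphic to the path algebra (over $\mathbb{C}$) of the quiver with two sources $p_1,p_2$, two sinks $q_1,q_2$, and one arrow $p_i\to q_j$ for every $i,j\in\{1,2\}$.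
   Context: Index the standard basis of $\mathbb{C}^N$ by $j\in\mathbb{Z}/N\mathbb{Z}$ (writing $\epsilon_j$) and define $t\epsilon_j=\epsilon_{j-1}$, $d\epsilon_j=\omega^j\epsilon_j$. For $u\neq0$, $u^N\neq1$, the operator $ud-u^{-1}d^{-1}$ is invertible; put $s=(ud-u^{-1}d^{-1})^{-1}$ and, on $\mathbb{C}^{2N}=\mathbb{C}^N\oplus\mathbb{C}^N$, $$T=\begin{pmatrix}t&0\\0&t^{-1}\end{pmatrix},\qquad \Lambda=\begin{pmatrix}s&s\\-s&-s\end{pmatrix}.$$ $A=A_{N,u}$ is the unital subalgebra of $\operatorname{End}(\mathbb{C}^{2N})$ generated by $T$ and $\Lambda$. For $a\in\mathbb{Z}/N\mathbb{Z}$, $e_a=\frac1N\sum_{k=0}^{N-1}\omega^{-ak}T^k$, and the level of $a$ is $\ell(a)=\min\{\bar a,N-\bar a\}$ with $\bar a\in\{0,\ldots,N-1\}$ the standard representative. Infinite representation type means that there are infinitely many isomorphism classes of finite-dimensional indecomposable modules. *)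

(* Defs.v *)
From HB Require Import structures.
From mathcomp Require Import all_boot all_order all_algebra all_field.
From mathcomp Require Import complex reals trigo.

Set Implicit Arguments.
Unset Strict Implicit.
Unset Printing Implicit Defensive.

Import Order.TTheory GRing.Theory Num.Theory.
Local Open Scope ring_scope.
Local Open Scope complex_scope.

Definition surj (X Y : Type) (f : X -> Y) : Prop := forall y, exists x, f x = y.

Section Modules.
Variable A : nzRingType.

Definition zero_module (M : lmodType A) : Prop := forall x : M, x = 0.

Definition module_iso (M M' : lmodType A) : Prop :=
  exists f : {linear M -> M'}, bijective f.

Definition indecomposable (M : lmodType A) : Prop :=
  ~ zero_module M /\
  forall U V : lmodType A,
    module_iso M (U * V)%type -> zero_module U \/ zero_module V.

Definition projective (P : lmodType A) : Prop :=
  forall (U V : lmodType A) (g : {linear U -> V}) (f : {linear P -> V}),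
    surj g -> exists h : {linear P -> U}, forall x, g (h x) = f x.

Definition exact_at (U V W : lmodType A)
    (f : {linear U -> V}) (g : {linear V -> W}) : Prop :=
  forall y : V, g y = 0 <-> exists x, f x = y.

(* A projective resolution ... -> P 1 -> P 0 -> M -> 0 with P i = 0 for i > m *)
Definition projdim_le (M : lmodType A) (m : nat) : Prop :=
  exists (P : nat -> lmodType A) (d : forall i, {linear P i.+1 -> P i})
         (aug : {linear P 0%N -> M}),
    [/\ forall i, projective (P i),
        surj aug,
        exact_at (d 0%N) aug,
        forall i, exact_at (d i.+1) (d i)
      & forall i, (m < i)%N -> zero_module (P i)].

Definition gldim_le (m : nat) : Prop :=
  forall M : lmodType A, projdim_le M m.

Definition gldim_infinite : Prop := forall m, ~ gldim_le m.

End Modules.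

Section Algebras.
Variable K : fieldType.

(* An A-module is a K-vector space through the structure map c |-> c%:A. *)
Definition findim_module (A : algType K) (M : lmodType A) : Prop :=
  exists (k : nat) (v : 'I_k -> M), forall x : M,
    exists c : 'I_k -> K, x = \sum_i (c i)%:A *: v i.

Definition infinite_rep_type (A : algType K) : Prop :=
  exists M : nat -> lmodType A,
    (forall i, findim_module (M i) /\ indecomposable (M i)) /\
    (forall i j, module_iso (M i) (M j) -> i = j).

Definition two_sided_ideal (A : algType K) (I : A -> Prop) : Prop :=
  [/\ I 0, forall x y, I x -> I y -> I (x + y)
    & forall a x, I x -> I (a * x) /\ I (x * a)].

(* B is isomorphic to A / I through the map induced by f *)
Definition quotient_iso (A : algType K) (I : A -> Prop) (B : algType K) : Prop :=
  exists f : {lrmorphism A -> B}, surj f /\ forall x, f x = 0 <-> I x.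

End Algebras.

Record quiver := Quiver {
  vertex : finType;
  arrow : finType;
  source : arrow -> vertex;
  target : arrow -> vertex }.

Section Paths.
Variable Q : quiver.

Fixpoint is_path (v : vertex Q) (s : seq (arrow Q)) : bool :=
  if s is a :: s' then (source a == v) && is_path (target a) s' else true.

(* The starting vertex is kept so that there is one path of length 0 at
   each vertex. *)
Definition qpath := {p : vertex Q * seq (arrow Q) | is_path p.1 p.2}.

Definition path_start (p : qpath) : vertex Q := (val p).1.

Definition path_end (p : qpath) : vertex Q :=
  last (val p).1 (map (@target Q) (val p).2).

(* r is "p, followed by q" *)
Definition is_concat (p q r : qpath) : Prop :=
  path_end p = path_start q /\
  val r = (path_start p, (val p).2 ++ (val q).2).

Definition trivial_path (v : vertex Q) : qpath :=
  exist (fun p : vertex Q * seq (arrow Q) => is_path p.1 p.2) (v, [::]) isT.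

(* B is the path algebra K Q: it has the paths of Q as a K-basis (through b),
   the product is concatenation of composable paths, and 0 for other pairs of
   paths; the unit is the sum of the paths of length 0. *)
Definition is_path_algebra (K : fieldType) (B : algType K) : Prop :=
  exists b : qpath -> B,
    [/\ forall x : B, exists (s : seq qpath) (c : qpath -> K),
          x = \sum_(p <- s) c p *: b p,
        forall (s : seq qpath) (c : qpath -> K), uniq s ->
          \sum_(p <- s) c p *: b p = 0 -> forall p, p \in s -> c p = 0,
        forall p q r, is_concat p q r -> b p * b q = b r,
        forall p q, path_end p <> path_start q -> b p * b q = 0
      & 1 = \sum_(v : vertex Q) b (trivial_path v)].

End Paths.

(* Vertices p_i = inl i and q_j = inr j; the arrow (i, j) goes from p_i to q_j. *)
Definition quiver22 : quiver :=
  @Quiver ('I_2 + 'I_2)%type ('I_2 * 'I_2)%type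
    (fun a => inl a.1) (fun a => inr a.2).

Section TheAlgebra.
Variables (R : realType) (N : nat) (u : R[i]).

(* exp (2 pi i / N), by Euler's formula *)
Definition omega : R[i] :=
  cos (2 * pi / N%:R) +i* sin (2 * pi / N%:R).

(* The rows and columns are indexed by 'Z_N, which is 'I_(Zp_trunc N).+2, a copy
   of Z/N when N > 1. Matrices act on column vectors; column j is the image of
   epsilon_j. *)
Notation dimN := (Zp_trunc N).+2.
Notation EndV := 'M[R[i]]_dimN.
Notation EndVV := 'M[R[i]]_(dimN + dimN).

Definition opt : EndV := \matrix_(i, j) (i == j - 1 :> 'Z_N)%:R.

Definition opd : EndV := \matrix_(i, j) (omega ^+ j *+ (i == j)).

Definition ops : EndV := invmx (u *: opd - u^-1 *: invmx opd).

Definition opT : EndVV := block_mx opt 0 0 (invmx opt).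

Definition opLambda : EndVV := block_mx ops ops (- ops) (- ops).

Definition algA : {aspace EndVV} := <<1 & [:: opT; opLambda]>>%AS.

Definition idem (a : 'Z_N) : EndVV :=
  N%:R^-1 *: \sum_(0 <= k < N) omega ^- (a * k)%N *: opT ^+ k.

Definition level (a : 'Z_N) : nat := minn a (N - a).

(* dim (e_a A e_b) *)
Definition cartan (a b : 'Z_N) : nat :=
  \dim (<[idem a]> * algA * <[idem b]>)%VS.

Definition cartan_mx : EndV := \matrix_(a, b) (cartan a b)%:R.

End TheAlgebra.

(* Main.v *)
(* Decompose C^2N into the N eigenspaces of T, which are planes. Since N is even,
   s is a combination of the odd powers of d, and every component e_b Lambda e_a
   with a - b odd has rank one; the others vanish. Its kernel depends only on a
   and on whether the level goes up or down, and likewise its image on b; the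
   up-image at a vertex is the down-kernel there, and conversely. In a basis
   adapted to these lines Lambda splits into a part raising and a part lowering
   the level, so A consists of the pairs (X, Y) of N x N matrices, X supported
   on a = b or level a < level b, Y on a = b or level a > level b, with the same
   diagonal. The center and the Cartan matrix are read off from this basis.

   For the global dimension, the arrows between the vertices 0 and 1 compose to
   zero in both directions, and the Yoneda products of the corresponding
   extensions never vanish: in any projective resolution of the simple module
   S_0 one finds elements p_i of P_i with d p_(i+1) = (arrow) p_i, and A-linear
   maps from P_i to S_0 or S_1, alternately, taking the value 1 at p_i.

   The coefficients at the vertices 1, -1 (level 1) and 0, 2 (levels 0 and 2)
   give the path algebra quotient, and pulling back the modules of dimension
   vector (1, 1, 1, 1) with one arrow scaled by k gives pairwise non-isomorphic
   indecomposables. *)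

Require Import Defs.
From HB Require Import structures.
From mathcomp Require Import all_boot all_order all_algebra all_field.
From mathcomp Require Import complex reals trigo.
From mathcomp Require Import zify ring lra.
Import Order.TTheory GRing.Theory Num.Theory.
Local Open Scope ring_scope.

Set Implicit Arguments.
Unset Strict Implicit.
Unset Printing Implicit Defensive.

Lemma invmx_eq (K : fieldType) (k : nat) (A B : 'M[K]_k) :
  A *m B = 1%:M -> invmx A = B.
Proof.
move=> AB; have [uA _] := mulmx1_unit AB.
by rewrite -[B]mul1mx -(mulVmx uA) -mulmxA AB mulmx1.
Qed.

(** * Residues modulo N: representatives, parity and level *)

Section Residues.
Variables (n N : nat).
Hypotheses (N2n : N = (2 * n)%N) (N_ge4 : (4 <= N)%N).
Notation dimN := (Zp_trunc N).+2.

Lemma dimNE : dimN = N. Proof. by apply: Zp_cast; lia. Qed.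

Lemma ltZN (a : 'Z_N) : (a < N)%N. Proof. by rewrite -[X in (_ < X)%N]dimNE ltn_ord. Qed.

Lemma modZD (a b : 'Z_N) : ((a + b)%R = (a + b) %% N :> nat)%N.
Proof. by rewrite /=; congr (_ %% _)%N; apply: dimNE. Qed.

Lemma modZN (a : 'Z_N) : ((- a)%R = (N - a) %% N :> nat)%N.
Proof. by rewrite /=; congr ((_ - _) %% _)%N; apply: dimNE. Qed.

Lemma modZM (a b : 'Z_N) : ((a * b)%R = (a * b) %% N :> nat)%N.
Proof. by rewrite /=; congr (_ %% _)%N; apply: dimNE. Qed.

Lemma valZD (a b : 'Z_N) :
  (a + b : 'Z_N) = (if a + b < N then a + b else a + b - N)%N :> nat.
Proof.
have := ltZN a; have := ltZN b => hb ha; rewrite modZD; case: ltnP => h.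
  by rewrite modn_small.
by rewrite -{1}(subnK h) modnDr modn_small //; lia.
Qed.

Lemma valZN (a : 'Z_N) :
  (- a : 'Z_N) = (if a == 0%N :> nat then 0 else N - a)%N :> nat.
Proof.
have := ltZN a => ha; rewrite modZN; case: eqP => h.
  by rewrite h subn0 modnn.
by rewrite modn_small //; lia.
Qed.

Lemma oddN : odd N = false. Proof. by rewrite N2n oddM. Qed.

Lemma oddZD (a b : 'Z_N) : odd (a + b)%R = odd a (+) odd b.
Proof.
rewrite valZD; case: ifP => h; first by rewrite oddD.
by rewrite oddB ?oddD ?oddN ?addbF //; lia.
Qed.

Lemma oddZN (a : 'Z_N) : odd (- a)%R = odd a.
Proof.
rewrite valZN; case: eqP => [->//|h].
by have := ltZN a => ha; rewrite oddB ?oddN // ltnW.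
Qed.

Lemma level_le (a : 'Z_N) : (level a <= n)%N.
Proof. by have := ltZN a; rewrite /level; lia. Qed.

Lemma odd_level (a : 'Z_N) : odd (level a) = odd a.
Proof.
have := ltZN a; rewrite /level minnE => h.
case: (leqP a (N - a)%N) => h'; first by rewrite (eqP h') subn0.
by rewrite subKn ?oddB ?oddN // ltnW.
Qed.

Definition natZ (l : nat) : 'Z_N := inZp l.

Lemma val_natZ l : (l < N)%N -> natZ l = l :> nat.
Proof. by move=> h; rewrite /= modn_small // dimNE. Qed.

Lemma level_natZ l : (l <= n)%N -> level (natZ l) = l.
Proof. by move=> h; rewrite /level val_natZ; lia. Qed.

(** For [a + b] odd, parity excludes [a = b] and [a + b = N], so the signs of [a - b] and
    [a + b - N] leave four cases. They decide which level is smaller and on which side of [n] the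
    vertex of smaller level lies; the entries of both blocks of Lambda are computed by this
    split. *)
Variant level_cmp_spec (a b : nat) :
    bool -> bool -> bool -> bool -> bool -> bool -> bool -> Type :=
  | LevRelUpLow : level_cmp_spec a b true false false true (b <= n)%N true false
  | LevRelUpHigh : level_cmp_spec a b false true true false (b <= n)%N true false
  | LevRelDownLow : level_cmp_spec a b false true false (a <= n)%N true false true
  | LevRelDownHigh : level_cmp_spec a b true false true (a <= n)%N false false true.

Lemma level_cmpP (a b : 'Z_N) : odd (a + b) ->
  level_cmp_spec a b (a < b)%N (b < a)%N (N < a + b)%N (a <= n)%N (b <= n)%N
    (level a < level b)%N (level b < level a)%N.
Proof.
move=> ho; have ha := ltZN a; have hb := ltZN b; rewrite /level.
have hN : (a + b != N)%N by apply: contraTneq ho => ->; rewrite oddN.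
have hE : (a != b :> nat) by apply: contraTneq ho => ->; rewrite addnn odd_double.
move: (a : nat) (b : nat) ha hb hN hE => i j ha hb hN hE.
case: (ltngtP i j) hE => // hij _; case: (ltngtP N (i + j)%N) hN => // hs _.
- rewrite (_ : (j <= n)%N = false); last by lia.
  rewrite (_ : (minn i _ < _)%N = false); last by lia.
  rewrite (_ : (minn j _ < _)%N); last by lia.
  exact: LevRelDownHigh.
- rewrite (_ : (i <= n)%N); last by lia.
  rewrite (_ : (minn i _ < _)%N); last by lia.
  rewrite (_ : (minn j _ < _)%N = false); last by lia.
  exact: LevRelUpLow.
- rewrite (_ : (i <= n)%N = false); last by lia.
  rewrite (_ : (minn i _ < _)%N); last by lia.
  rewrite (_ : (minn j _ < _)%N = false); last by lia.
  exact: LevRelUpHigh.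
- rewrite (_ : (j <= n)%N); last by lia.
  rewrite (_ : (minn i _ < _)%N = false); last by lia.
  rewrite (_ : (minn j _ < _)%N); last by lia.
  exact: LevRelDownLow.
Qed.

End Residues.

(** * Characters of Z/N and their orthogonality *)

Definition zchar (K : fieldType) (N : nat) (w : K) (a : 'Z_N) : K := w ^+ a.

Section Characters.
Variables (K : fieldType) (n N : nat) (w : K).
Hypotheses (N2n : N = (2 * n)%N) (N_ge4 : (4 <= N)%N).
Hypothesis w_prim : N.-primitive_root w.

Let dimNE := dimNE N2n N_ge4.
Let ltZN := ltZN N2n N_ge4.
Let modZD := modZD N2n N_ge4.
Let modZM := modZM N2n N_ge4.

Notation chi := (@zchar K N w).

Lemma chiD (a b : 'Z_N) : chi (a + b) = chi a * chi b.
Proof. by rewrite /zchar -exprD modZD prim_expr_mod. Qed.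

Lemma chi0 : chi 0 = 1. Proof. by rewrite /zchar expr0. Qed.

Lemma chi_neq0 (a : 'Z_N) : chi a != 0.
Proof.
apply/eqP => h; have := chiD a (- a).
by rewrite subrr chi0 h mul0r => /eqP; rewrite oner_eq0.
Qed.

Lemma chiN (a : 'Z_N) : chi (- a) = (chi a)^-1.
Proof. by apply: (mulfI (chi_neq0 a)); rewrite -chiD subrr chi0 divff ?chi_neq0. Qed.

Lemma chiM (a b : 'Z_N) : chi (a * b) = w ^+ (a * b).
Proof. by rewrite /zchar modZM prim_expr_mod. Qed.

Lemma chi_eq1 (a : 'Z_N) : (chi a == 1) = (a == 0).
Proof.
rewrite /zchar -(prim_order_dvd w_prim) -val_eqE /=.
by apply/idP/eqP => [|->//]; have := ltZN a; case: (val a) => // m h /dvdn_leq; lia.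
Qed.

Lemma N_neq0 : N%:R != 0 :> K.
Proof. exact: prim_root_natf_neq0 w_prim. Qed.

(** Translating the summation index by 1 multiplies the sum by [chi b], which differs from 1 when
    [b] is nonzero. *)
Lemma chi_sum (b : 'Z_N) :
  \sum_(j : 'Z_N) chi (j * b) = if b == 0 then N%:R else 0.
Proof.
case: eqP => [->|/eqP hb].
  under eq_bigr do rewrite mulr0 chi0.
  by rewrite sumr_const card_ord dimNE.
set s := LHS; have : chi b * s = s.
  rewrite /s mulr_sumr [RHS](reindex_inj (addIr (1 : 'Z_N))) /=.
  by apply: eq_bigr => j _; rewrite mulrDl mul1r chiD mulrC.
move/eqP; rewrite -subr_eq0 -{2}[s]mul1r -mulrBl mulf_eq0 subr_eq0 chi_eq1.
by rewrite (negPf hb) /= => /eqP.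
Qed.

End Characters.

(** * The eigenbasis of T and the block form of Lambda *)

Section Diagonalisation.
Variables (K : fieldType) (n N : nat) (w u : K).
Hypotheses (N2n : N = (2 * n)%N) (N_ge4 : (4 <= N)%N).
Hypotheses (w_prim : N.-primitive_root w) (u_neq0 : u != 0).
Hypothesis uN_neq1 : u ^+ N != 1.
Notation dimN := (Zp_trunc N).+2.
Notation q := (u ^+ N).

Let dimNE := dimNE N2n N_ge4.
Let ltZN := ltZN N2n N_ge4.
Let valZD := valZD N2n N_ge4.
Let valZN := valZN N2n N_ge4.
Let oddZD := oddZD N2n N_ge4.
Let oddZN := oddZN N2n N_ge4.
Let oddN := oddN N2n.
Let chiD := chiD N2n N_ge4 w_prim.
Let chiN := chiN N2n N_ge4 w_prim.
Let chiM := chiM N2n N_ge4 w_prim.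
Let chi_neq0 := chi_neq0 N2n N_ge4 w_prim.
Let chi_sum := chi_sum N2n N_ge4 w_prim.
Let N_neq0 := N_neq0 w_prim.
Notation chi := (@zchar K N w).

(* The columns of fourier and fourierN are u^a f_a and u^-a f_-a, where
   f_a = sum_j w^(ja) epsilon_j is an eigenvector of t. With these scalings the
   matrix of s involves only powers of q = u^N. *)
Definition fourier : 'M[K]_dimN := \matrix_(j, a) (chi ((j : 'Z_N) * a) * u ^+ a).
Definition fourierN : 'M[K]_dimN := \matrix_(j, a) (chi (- ((j : 'Z_N) * a)) * u ^- a).
Definition fourierV : 'M[K]_dimN :=
  \matrix_(a, j) (N%:R^-1 * (chi (- ((j : 'Z_N) * a)) * u ^- a)).
Definition fourierNV : 'M[K]_dimN :=
  \matrix_(a, j) (N%:R^-1 * (chi ((j : 'Z_N) * a) * u ^+ a)).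

Lemma fourierVK : fourierV *m fourier = 1%:M.
Proof.
apply/matrixP => a b; rewrite !mxE.
have -> : \sum_j fourierV a j * fourier j b
    = N%:R^-1 * u ^- a * u ^+ b * \sum_(j : 'Z_N) chi (j * (b - a)).
  rewrite mulr_sumr; apply: eq_bigr => j _.
  by rewrite !mxE mulrBr chiD; ring.
rewrite chi_sum subr_eq0 [b == a]eq_sym; case: eqP => [->|_]; last by rewrite mulr0.
by rewrite /=; field; rewrite N_neq0 expf_neq0.
Qed.

Lemma fourierNVK : fourierNV *m fourierN = 1%:M.
Proof.
apply/matrixP => a b; rewrite !mxE.
have -> : \sum_j fourierNV a j * fourierN j b
    = N%:R^-1 * u ^+ a * u ^- b * \sum_(j : 'Z_N) chi (j * (a - b)).
  rewrite mulr_sumr; apply: eq_bigr => j _.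
  by rewrite !mxE mulrBr chiD; ring.
rewrite chi_sum subr_eq0; case: eqP => [->|_]; last by rewrite mulr0.
by rewrite /=; field; rewrite N_neq0 expf_neq0.
Qed.

Definition shift_mx : 'M[K]_dimN := \matrix_(i, j) (i == j - 1 :> 'Z_N)%:R.

Definition char_mx : 'M[K]_dimN := diag_mx (\row_a chi a).

Lemma shiftE (A : 'M[K]_dimN) i a : (shift_mx *m A) i a = A (i + 1 : 'Z_N) a.
Proof.
rewrite mxE (bigD1 (i + 1 : 'Z_N)) //= mxE addrK eqxx mul1r big1 ?addr0 // => j hj.
rewrite mxE; case: eqP => [h|_]; last by rewrite mul0r.
by rewrite h subrK eqxx in hj.
Qed.

Lemma shift_fourier : shift_mx *m fourier = fourier *m char_mx.
Proof.
apply/matrixP => i a; rewrite shiftE mul_mx_diag !mxE mulrDl mul1r chiD; ring.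
Qed.

Lemma shift_fourierN : shift_mx *m (fourierN *m char_mx) = fourierN.
Proof.
apply/matrixP => i a; rewrite shiftE mul_mx_diag !mxE mulrDl mul1r opprD chiD.
rewrite (chiN a); field; by rewrite chi_neq0 expf_neq0.
Qed.

Lemma shift_unit : shift_mx \in unitmx.
Proof.
have h := shift_fourierN; have uN : fourierN \in unitmx by have [] := mulmx1_unit fourierNVK.
by move: uN; rewrite -{1}h unitmx_mul => /andP[].
Qed.

Lemma invshift_fourierN : invmx shift_mx *m fourierN = fourierN *m char_mx.
Proof. by rewrite -{1}shift_fourierN mulKmx ?shift_unit. Qed.

Lemma odd_sum_half (f : nat -> K) m :
  \sum_(k < 2 * m | odd k) f k = \sum_(k < m) f k.*2.+1.
Proof.
elim: m => [|m IH]; first by rewrite !big_ord0.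
rewrite mulnS add2n big_mkcond /= !big_ord_recr /= -big_mkcond /= IH.
by rewrite mul2n odd_double /= addr0.
Qed.

Notation c := ((q - 1)^-1).

Lemma q1_neq0 : q - 1 != 0. Proof. by rewrite subr_eq0. Qed.

(** Coefficients of s as a polynomial in d: since d^N = 1, the geometric sum of the first n powers
    of u^2 d^2 equals (q - 1)/(u^2 d^2 - 1), and s = u d / (u^2 d^2 - 1). *)
Definition sigma (k : 'Z_N) : K := if odd k then c * u ^+ k else 0.

Definition sdiag (j : 'Z_N) : K := \sum_(k : 'Z_N) sigma k * chi (j * k).

Lemma odd_geom (X : K) : \sum_(k < dimN | odd k) c * u ^+ k * X ^+ k =
  u * X * (c * \sum_(m < n) (u ^+ 2 * X ^+ 2) ^+ m).
Proof.
rewrite -(big_mkord odd (fun k => c * u ^+ k * X ^+ k)) dimNE.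
rewrite [X in \sum_(0 <= k < X | _) _]N2n big_mkord.
rewrite (odd_sum_half (fun k => c * u ^+ k * X ^+ k)) !mulr_sumr; apply: eq_bigr => m _.
have -> : (u ^+ 2 * X ^+ 2) ^+ m = (u * X) ^+ m.*2 by rewrite -exprMn -exprM mul2n.
by rewrite -mulrA -exprMn exprS mulrCA.
Qed.

Lemma sdiagE (j : 'Z_N) : (u * chi j - u^-1 * (chi j)^-1) * sdiag j = 1.
Proof.
have cj := chi_neq0 j.
set y := u ^+ 2 * (chi j) ^+ 2.
have -> : sdiag j = u * chi j * (c * \sum_(m < n) y ^+ m).
  rewrite /sdiag /sigma -odd_geom [RHS]big_mkcond.
  apply: eq_bigr => k _; case: ifP => _; last by rewrite mul0r.
  by rewrite chiM exprM.
have yq : y ^+ n = q.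
  rewrite /y -exprMn -exprM -N2n exprMn -{2}(mulr1 (u ^+ N)); congr (_ * _).
  by rewrite /zchar -exprM mulnC exprM (prim_expr_order w_prim) expr1n.
have := subrX1 y n; rewrite yq => h.
have -> : (u * chi j - u^-1 * (chi j)^-1) = (u * chi j)^-1 * (y - 1).
  by rewrite /y; field; rewrite cj.
transitivity (c * ((y - 1) * \sum_(i < n) y ^+ i)); last by rewrite -h mulVf ?q1_neq0.
by field; rewrite cj u_neq0 q1_neq0.
Qed.

Definition d_mx : 'M[K]_dimN := \matrix_(i, j) (w ^+ j *+ (i == j)).

Lemma d_mxE : d_mx = char_mx.
Proof. by apply/matrixP => i j; rewrite !mxE; case: eqP => [->|]. Qed.

Lemma invmx_d : invmx d_mx = diag_mx (\row_a (chi a)^-1).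
Proof.
apply: invmx_eq; rewrite d_mxE mul_diag_mx; apply/matrixP => i j; rewrite !mxE.
by case: eqP => [->|]; rewrite ?mulr0 //= mulr1n divff ?chi_neq0.
Qed.

Definition s_mx : 'M[K]_dimN := invmx (u *: d_mx - u^-1 *: invmx d_mx).

Lemma s_mxE : s_mx = diag_mx (\row_j sdiag j).
Proof.
apply: invmx_eq; rewrite invmx_d d_mxE; apply/matrixP => i j.
rewrite mul_mx_diag !mxE; case: eqP => [->|]; rewrite ?mulr1n ?sdiagE //.
by rewrite !mulr0n !mulr0 subrr mul0r.
Qed.

(** Since d^k maps f_a to f_(a+k), s has a matrix between any two of the bases u^a f_a and u^-a
    f_-a. The exponent k is b - a, a + b, -a - b or a - b; the powers of q record the carries when k
    is replaced by its representative below N. *)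
Definition s11 : 'M[K]_dimN :=
  \matrix_(b, a) if odd (a + b) then c * (if (b < a)%N then q else 1) else 0.
Definition s12 : 'M[K]_dimN :=
  \matrix_(b, a) if odd (a + b) then c * (if (N < a + b)%N then q^-1 else 1) else 0.
Definition s21 : 'M[K]_dimN :=
  \matrix_(b, a) if odd (a + b) then c * (if (N < a + b)%N then q ^+ 2 else q) else 0.
Definition s22 : 'M[K]_dimN :=
  \matrix_(b, a) if odd (a + b) then c * (if (a < b)%N then q else 1) else 0.

Lemma sigmaB (a b : 'Z_N) : sigma (b - a) =
  if odd (a + b) then c * ((if (b < a)%N then q else 1) * u ^+ b * u ^- a) else 0.
Proof.
rewrite /sigma oddZD oddZN addbC -oddD; case: ifP => // hab; congr (_ * _).
have ha := ltZN a; have hb := ltZN b.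
have ua k : u ^+ k != 0 by rewrite expf_neq0.
apply: (mulIf (ua (a : nat))); rewrite -!mulrA mulVf // mulr1 -exprD.
have -> : ((b - a)%R + a = if (b < a)%N then N + b else b)%N.
  by rewrite valZD valZN; do !case: ifP => //; lia.
by case: ifP; rewrite ?exprD ?mul1r.
Qed.

Lemma sigmaD (a b : 'Z_N) : sigma (a + b) =
  if odd (a + b) then c * ((if (N < a + b)%N then q^-1 else 1) * u ^+ a * u ^+ b) else 0.
Proof.
rewrite /sigma oddZD -oddD; case: ifP => // hab; congr (_ * _).
have ha := ltZN a; have hb := ltZN b.
have N0 : q != 0 by rewrite expf_neq0.
rewrite -mulrA -exprD valZD ltnNge leq_eqVlt.
have -> : (N == a + b)%N = false by apply/eqP => h; rewrite -h oddN in hab.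
rewrite orFb; case: ltnP => h /=; last by rewrite mul1r.
by apply: (mulfI N0); rewrite -exprD subnKC 1?ltnW // mulrA divff // mul1r.
Qed.

Lemma sigmaN (a b : 'Z_N) : sigma (- a - b) =
  if odd (a + b)
  then c * ((if (N < a + b)%N then q ^+ 2 else q) * u ^- a * u ^- b) else 0.
Proof.
rewrite /sigma oddZD !oddZN -oddD; case: ifP => // hab; congr (_ * _).
have ha := ltZN a; have hb := ltZN b.
have ua k : u ^+ k != 0 by rewrite expf_neq0.
have hN : (a + b == N)%N = false by apply/eqP => h; rewrite h oddN in hab.
apply: (mulIf (ua (a + b)%N)); rewrite -exprD.
have -> : ((- a - b)%R + (a + b) = if (N < a + b)%N then N + N else N)%N.
  rewrite valZD !valZN; move: hab hN; move: (a : nat) (b : nat) ha hb => {}a {}b.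
  move=> ha hb hab; do !case: ifP => //; lia.
by case: ifP => _; rewrite !exprD; field; rewrite !ua.
Qed.

(** Leaving the eigenvalue of s as a sum over k lets the next four lemmas compare both sides
    termwise after the substitution k = b - a, a + b, -a - b or a - b. *)
Lemma s_mx_mulE (A : 'M[K]_dimN) j a : (s_mx *m A) j a =
  \sum_(k : 'Z_N) sigma k * chi ((j : 'Z_N) * k) * A j a.
Proof. by rewrite s_mxE mul_diag_mx !mxE mulr_suml. Qed.

Lemma s_fourier : s_mx *m fourier = fourier *m s11.
Proof.
apply/matrixP => j a; rewrite s_mx_mulE (reindex_inj (addIr (- a : 'Z_N))) [RHS]mxE /=.
apply: eq_bigr => b _; rewrite !mxE sigmaB; case: ifP => _; last by rewrite !mul0r mulr0.
rewrite mulrBr chiD chiN; field.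
by rewrite q1_neq0 chi_neq0 expf_neq0.
Qed.

Lemma s_fourierN : s_mx *m fourierN = fourier *m s12.
Proof.
apply/matrixP => j a; rewrite s_mx_mulE (reindex_inj (addrI (a : 'Z_N))) [RHS]mxE /=.
apply: eq_bigr => b _; rewrite !mxE sigmaD; case: ifP => _; last by rewrite !mul0r mulr0.
rewrite mulrDr chiD chiN; case: ifP => _; field;
by rewrite ?q1_neq0 ?chi_neq0 ?expf_neq0.
Qed.

Lemma s_fourier' : s_mx *m fourier = fourierN *m s21.
Proof.
apply/matrixP => j a; rewrite s_mx_mulE [RHS]mxE.
rewrite (reindex_inj (inj_comp (addrI (- a : 'Z_N)) (@oppr_inj _))) /=.
apply: eq_bigr => b _; rewrite !mxE sigmaN; case: ifP => _; last by rewrite !mul0r mulr0.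
rewrite mulrDr !mulrN chiD !chiN; field.
by rewrite q1_neq0 !chi_neq0 !expf_neq0.
Qed.

Lemma s_fourierN' : s_mx *m fourierN = fourierN *m s22.
Proof.
apply/matrixP => j a; rewrite s_mx_mulE [RHS]mxE.
rewrite (reindex_inj (inj_comp (addrI (a : 'Z_N)) (@oppr_inj _))) /=.
apply: eq_bigr => b _; rewrite !mxE sigmaB addnC; case: ifP => _; last by rewrite !mul0r mulr0.
rewrite mulrDr !mulrN chiD !chiN; field.
by rewrite q1_neq0 !chi_neq0 !expf_neq0.
Qed.

(* In the eigenspace of T for w^a, spanned by x_a = (u^a f_a, 0) and
   y_a = (0, u^-a f_-a), the line of x_a - q y_a contains the images of all
   components of Lambda coming from a lower level and is killed by those going
   to a lower level; the line of x_a - z_a y_a plays the same role for higher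
   levels. *)
Definition zd (a : 'Z_N) : K := if (a <= n)%N then 1 else q ^+ 2.
Notation Z := (diag_mx (\row_a zd a)).
Notation W := (diag_mx (\row_a (q - zd a)^-1)).
Notation blk A B := (block_mx A 0 0 B : 'M[K]_(dimN + dimN)).

Definition eigenbasis : 'M[K]_(dimN + dimN) :=
  blk fourier fourierN *m block_mx 1%:M 1%:M (- q%:M) (- Z).
Definition eigenbasisV : 'M[K]_(dimN + dimN) :=
  block_mx (- (Z *m W)) (- W) (q%:M *m W) W *m blk fourierV fourierNV.

(** This is the determinant of the base change in the plane over [a]: the two lines are distinct
    because q is neither 0 nor 1. *)
Lemma qz_neq0 (a : 'Z_N) : q - zd a != 0.
Proof.
rewrite /zd; case: ifP => _; first exact: q1_neq0.
have -> : q - q ^+ 2 = q * (1 - q) by ring.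
by rewrite mulf_neq0 ?expf_neq0 // subr_eq0 eq_sym.
Qed.

Lemma eigenbasisVK : eigenbasisV *m eigenbasis = 1%:M.
Proof.
have Wq : q%:M *m W - W *m Z = 1%:M.
  rewrite mul_scalar_mx mul_diag_mx; apply/matrixP => i j; rewrite !mxE.
  by case: eqP => [->|_]; rewrite ?mulr1n ?mulr0n ?mulr0 ?subrr //=; field; apply: qz_neq0.
have WZ : Z *m W = W *m Z by apply: diag_mxC.
have Wc : q%:M *m W = W *m q%:M by rewrite scalar_mxC.
rewrite /eigenbasisV /eigenbasis mulmxA -[in X in X *m _]mulmxA mulmx_block fourierVK fourierNVK.
rewrite !mulmx0 !mul0mx !addr0 !add0r.
rewrite -(scalar_mx_block dimN dimN 1) mulmx1 mulmx_block !mulmx1 !mulNmx !mulmxN !opprK.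
rewrite WZ -Wc [- _ + q%:M *m _]addrC Wq addNr subrr.
by rewrite -scalar_mx_block.
Qed.

(** Both basis vectors over [a] have x-coordinate 1, so the block of Lambda on each family of lines
    is read off from first components. [Lambda_up_low] and [Lambda_dn_low] check that the second
    components agree. *)
Definition Lambda_up : 'M[K]_dimN := s11 - s12 *m q%:M.
Definition Lambda_dn : 'M[K]_dimN := s11 - s12 *m Z.

Definition T_mx : 'M[K]_(dimN + dimN) := block_mx shift_mx 0 0 (invmx shift_mx).
Definition Lambda_mx : 'M[K]_(dimN + dimN) := block_mx s_mx s_mx (- s_mx) (- s_mx).

Lemma T_eigen : T_mx *m eigenbasis = eigenbasis *m blk char_mx char_mx.
Proof.
have ZC : Z *m char_mx = char_mx *m Z by apply: diag_mxC.
rewrite /T_mx /eigenbasis mulmxA mulmx_block -[RHS]mulmxA [in RHS]mulmx_block.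
rewrite !mulmx0 !mul0mx !addr0 !add0r shift_fourier invshift_fourierN !mul1mx !mulNmx ZC.
rewrite -scalar_mxC -!mulmxN !mulmx_block !mul0mx !addr0 !add0r.
by rewrite !mulmx1 !mulmxA.
Qed.

(** In the four cases of [level_cmpP] the two terms differ by 1 - q, q - 1, 0 and 0, and the factor
    [c] cancels q - 1. *)
Lemma Lambda_upE (b a : 'Z_N) : Lambda_up b a =
  if odd (a + b) && (level a < level b)%N then (if (a <= n)%N then -1 else 1) else 0.
Proof using N2n N_ge4 u_neq0 uN_neq1.
have q0 : q != 0 by rewrite expf_neq0.
rewrite /Lambda_up mul_mx_scalar !mxE; case: ifP => [ho|]; last by rewrite mulr0 subrr.
case: (level_cmpP N2n N_ge4 ho) => //=; do ?case: ifP => _; field; by rewrite ?q0 ?q1_neq0.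
Qed.

Lemma Lambda_dnE (b a : 'Z_N) : Lambda_dn b a =
  if odd (a + b) && (level b < level a)%N then
    (if (a <= n)%N then (if (N < a + b)%N then q^-1 else 1)
     else (if (N < a + b)%N then -1 else - q)) else 0.
Proof using N2n N_ge4 u_neq0 uN_neq1.
have q0 : q != 0 by rewrite expf_neq0.
rewrite /Lambda_dn mul_mx_diag !mxE /zd; case: ifP => [ho|]; last by rewrite mul0r subrr.
case: (level_cmpP N2n N_ge4 ho) => //=; do ?case: ifP => _; field; by rewrite ?q0 ?q1_neq0.
Qed.

(** The y-coordinate of the image is -q times its x-coordinate, so Lambda preserves the family of
    lines of x_a - q y_a. *)
Lemma Lambda_up_low : s22 *m q%:M - s21 = - (q%:M *m Lambda_up).
Proof using N2n N_ge4 u_neq0 uN_neq1.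
apply/matrixP => b a.
have q0 : q != 0 by rewrite expf_neq0.
have qUE : (q%:M *m Lambda_up) b a = q * Lambda_up b a by rewrite mul_scalar_mx mxE.
rewrite [LHS]mxE [RHS]mxE qUE Lambda_upE mul_mx_scalar !mxE.
case: ifP => [ho|]; last by rewrite !mulr0 subrr oppr0.
case: (level_cmpP N2n N_ge4 ho) => //=; do ?case: ifP => _; field; by rewrite ?q0 ?q1_neq0.
Qed.

Lemma Lambda_dn_low : s22 *m Z - s21 = - (Z *m Lambda_dn).
Proof using N2n N_ge4 u_neq0 uN_neq1.
apply/matrixP => b a.
have q0 : q != 0 by rewrite expf_neq0.
have ZDE : (Z *m Lambda_dn) b a = zd b * Lambda_dn b a.
  by rewrite mul_diag_mx mxE [X in X * _]mxE.
rewrite [LHS]mxE [RHS]mxE ZDE Lambda_dnE mul_mx_diag !mxE /zd.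
case: ifP => [ho|]; last by rewrite mul0r mulr0 subrr oppr0.
case: (level_cmpP N2n N_ge4 ho) => //=; do ?case: ifP => _; field; by rewrite ?q0 ?q1_neq0.
Qed.

Lemma Lambda_eigen : Lambda_mx *m eigenbasis = eigenbasis *m blk Lambda_up Lambda_dn.
Proof.
rewrite /Lambda_mx /eigenbasis mulmxA mulmx_block !mulmx0 !addr0 !add0r !mulNmx.
have -> : block_mx (s_mx *m fourier) (s_mx *m fourierN)
                    (- (s_mx *m fourier)) (- (s_mx *m fourierN))
    = block_mx (fourier *m s11) (fourier *m s12)
               (- (fourierN *m s21)) (- (fourierN *m s22)).
  congr (block_mx _ _ (- _) (- _)); [exact: s_fourier | exact: s_fourierN
    | exact: s_fourier' | exact: s_fourierN'].
rewrite -[RHS]mulmxA [in RHS]mulmx_block !mulmx0 !addr0 !add0r !mul1mx !mulNmx.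
rewrite -Lambda_up_low -Lambda_dn_low !mulmx_block !mul0mx !addr0 !add0r !mulmx1.
rewrite !mulmxN !mulNmx !opprK /Lambda_up /Lambda_dn !mulmxBr !mulmxA.
by rewrite [- _ + _]addrC [- _ + (_ *m Z)]addrC.
Qed.

End Diagonalisation.

(** * The algebra of level-monotone pairs of matrices *)

Section Coefficients.
Variables (K : fieldType) (N : nat).
Notation dimN := (Zp_trunc N).+2.
Notation EndVV := 'M[K]_(dimN + dimN).
Variables Q V : EndVV.
Hypothesis VQ : V *m Q = 1%:M.
Notation blk A B := (block_mx A 0 0 B : EndVV).

Implicit Types (a b x y z : 'Z_N) (c d : 'M[K]_dimN).

Let QV : Q *m V = 1%:M. Proof. exact: mulmx1C VQ. Qed.

(** As for matrices acting on columns, the first index is the target and the second the source. *)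
Definition up x y := (x == y) || (level y < level x)%N.
Definition dn x y := (x == y) || (level x < level y)%N.
Definition linked x y := (x == y) || (level x != level y).
Definition monotone3 x y z := up x y && up y z || dn x y && dn y z.

Lemma linked_up_dn x y : linked x y = up x y || dn x y.
Proof. rewrite /linked /up /dn; case: eqP => //= _; lia. Qed.

(** The one point to exclude is a chain that is monotone downwards while [up x z] holds; then
    [x = z], no level can change, and all three vertices coincide. *)
Lemma up_trans x y z : up x y && up y z = up x z && monotone3 x y z.
Proof.
rewrite /monotone3 /up /dn; case: (eqVneq x y) => [<-|xy].
  by rewrite /=; case: (x == z) => //=; lia.
case: (eqVneq y z) => [<-|yz]; first by rewrite (negPf xy) /=; lia.
case: (eqVneq x z) => [->|_] /=; lia.
Qed.

Lemma dn_trans x y z : dn x y && dn y z = dn x z && monotone3 x y z.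
Proof.
rewrite /monotone3 /up /dn; case: (eqVneq x y) => [<-|xy].
  by rewrite /=; case: (x == z) => //=; lia.
case: (eqVneq y z) => [<-|yz]; first by rewrite (negPf xy) /=; lia.
case: (eqVneq x z) => [->|_] /=; lia.
Qed.

Definition up_mx c : 'M[K]_dimN := \matrix_(b, a) (c b a *+ up b a).
Definition dn_mx c : 'M[K]_dimN := \matrix_(b, a) (c b a *+ dn b a).

Lemma up_mxE c b a : up_mx c b a = c b a *+ up b a. Proof. by rewrite mxE. Qed.
Lemma dn_mxE c b a : dn_mx c b a = c b a *+ dn b a. Proof. by rewrite mxE. Qed.

(* Up to the base change Q, an element of A is a pair of matrices, one
   non-decreasing and one non-increasing for the level, with the same diagonal;
   both are stored in the single matrix c, whose entries at unlinked places are
   ignored. *)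
Definition of_coef c : EndVV := Q *m blk (up_mx c) (dn_mx c) *m V.

Fact of_coef_is_linear : linear of_coef.
Proof.
move=> k c d; rewrite /of_coef.
have -> : blk (up_mx (k *: c + d)) (dn_mx (k *: c + d))
   = k *: blk (up_mx c) (dn_mx c) + blk (up_mx d) (dn_mx d).
  rewrite scale_block_mx add_block_mx !scaler0 !addr0; congr block_mx;
  by apply/matrixP => i j; rewrite !mxE mulrnAr mulrnDl.
by rewrite mulmxDr mulmxDl -scalemxAr -scalemxAl.
Qed.
HB.instance Definition _ :=
  GRing.isLinear.Build K 'M[K]_dimN EndVV _ of_coef of_coef_is_linear.

(** Inverse to [of_coef] up to unlinked entries, which become 0. On the diagonal both blocks of an
    image of [of_coef] agree, and the first is read. *)
Definition to_coef (x : EndVV) : 'M[K]_dimN :=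
  \matrix_(b, a) (if up b a then (V *m x *m Q) (lshift _ b) (lshift _ a)
                  else (V *m x *m Q) (rshift _ b) (rshift _ a) *+ dn b a).

Fact to_coef_is_linear : linear to_coef.
Proof.
move=> k x y; rewrite /to_coef.
have -> : V *m (k *: x + y) *m Q = k *: (V *m x *m Q) + V *m y *m Q.
  by rewrite mulmxDr mulmxDl -scalemxAr -scalemxAl.
move: (V *m x *m Q) (V *m y *m Q) => X Y; apply/matrixP => i j; rewrite !mxE.
by case: ifP => _ //; rewrite mulrnAr mulrnDl.
Qed.
HB.instance Definition _ :=
  GRing.isLinear.Build K EndVV 'M[K]_dimN _ to_coef to_coef_is_linear.

Lemma conj_of_coef c : V *m of_coef c *m Q = blk (up_mx c) (dn_mx c).
Proof. by rewrite /of_coef !mulmxA VQ mul1mx -mulmxA VQ mulmx1. Qed.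

Lemma to_coef_of_coef c b a : to_coef (of_coef c) b a = c b a *+ linked b a.
Proof.
rewrite mxE conj_of_coef block_mxEul block_mxEdr linked_up_dn !mxE.
by case: (up b a); case: (dn b a).
Qed.

Lemma eq_of_coef c d : (forall b a, linked b a -> c b a = d b a) -> of_coef c = of_coef d.
Proof.
move=> h; rewrite /of_coef.
have -> : up_mx c = up_mx d.
  apply/matrixP => b a; rewrite !up_mxE; case e : (up b a) => //.
  by rewrite h // linked_up_dn e.
have -> // : dn_mx c = dn_mx d.
apply/matrixP => b a; rewrite !dn_mxE; case e : (dn b a) => //.
by rewrite h // linked_up_dn e orbT.
Qed.

Lemma of_coefK c : of_coef (to_coef (of_coef c)) = of_coef c.
Proof. by apply: eq_of_coef => b a h; rewrite to_coef_of_coef h. Qed.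

(** Both blocks are multiplied at once: a term through [y] survives only if the level is monotone
    along the chain. *)
Definition coef_mul c d : 'M[K]_dimN :=
  \matrix_(x, z) \sum_y (c x y * d y z *+ monotone3 x y z).

Lemma of_coefM c d : of_coef c * of_coef d = of_coef (coef_mul c d).
Proof.
rewrite -mulmxE /of_coef !mulmxA -[_ *m V *m Q]mulmxA VQ mulmx1; congr (_ *m V).
rewrite -mulmxA mulmx_block !mulmx0 !mul0mx !addr0 add0r; congr (_ *m _).
have -> : up_mx c *m up_mx d = up_mx (coef_mul c d).
  apply/matrixP => x z; rewrite !mxE -sumrMnl; apply: eq_bigr => y _.
  by rewrite !up_mxE mulrnAl mulrnAr -!mulrnA !mulnb [up y z && _]andbC up_trans andbC.
have -> // : dn_mx c *m dn_mx d = dn_mx (coef_mul c d).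
apply/matrixP => x z; rewrite !mxE -sumrMnl; apply: eq_bigr => y _.
by rewrite !dn_mxE mulrnAl mulrnAr -!mulrnA !mulnb [dn y z && _]andbC dn_trans andbC.
Qed.

Lemma of_coef1 : of_coef 1%:M = 1.
Proof.
rewrite /of_coef; have -> : up_mx 1%:M = 1%:M.
  by apply/matrixP => i j; rewrite !mxE /up; case: eqP => // _; rewrite mul0rn.
have -> : dn_mx 1%:M = 1%:M.
  by apply/matrixP => i j; rewrite !mxE /dn; case: eqP => // _; rewrite mul0rn.
by rewrite -scalar_mx_block mulmx1 QV.
Qed.

(* Basis vector of e_b A e_a if b and a are linked, 0 otherwise. *)
Definition belt b a : EndVV := of_coef (delta_mx b a).

Lemma belt_unlinked b a : ~~ linked b a -> belt b a = 0.
Proof.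
move=> h; rewrite /belt -(raddf0 of_coef); apply: eq_of_coef => b' a' h'; rewrite !mxE.
by case: eqP => [e|] //; case: eqP => [e'|] //; move: h'; rewrite e e' (negPf h).
Qed.

Lemma beltM x y z t : belt x y * belt z t = belt x t *+ ((y == z) && monotone3 x y t).
Proof.
rewrite /belt of_coefM -raddfMn; congr of_coef; apply/matrixP => i j; rewrite !mxE mulmxnE mxE.
rewrite (bigD1 y) //= big1 ?addr0 => [|k /negPf hk]; last by rewrite !mxE hk andbF mul0r mul0rn.
rewrite !mxE eqxx andbT; case: eqP => [->|]; last by rewrite mul0r !mul0rn.
case: eqP => /=; last by rewrite mulr0 !mul0rn mulr0n.
by case: eqP => [->|] _; rewrite ?mulr1 // mulr0 !mul0rn.
Qed.

Lemma of_coef_sum c : of_coef c = \sum_b \sum_a c b a *: belt b a.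
Proof.
rewrite {1}(matrix_sum_delta c) raddf_sum; apply: eq_bigr => b _.
by rewrite raddf_sum /=; apply: eq_bigr => a _; rewrite linearZ.
Qed.

(** Compression by diagonal idempotents isolates one coefficient. This extracts arrows from Lambda,
    constrains central elements and computes the corners of A. *)
Lemma belt_cut b a c : belt b b * of_coef c * belt a a = c b a *: belt b a.
Proof.
rewrite [in LHS]of_coef_sum mulr_sumr mulr_suml (bigD1 b) //= [X in _ + X]big1 ?addr0; last first.
  move=> x /negPf hx; rewrite mulr_sumr mulr_suml big1 // => y _.
  by rewrite -scalerAr beltM eq_sym hx mulr0n scaler0 mul0r.
rewrite mulr_sumr mulr_suml (bigD1 a) //= [X in _ + X]big1 ?addr0; last first.
  by move=> y /negPf hy; rewrite -scalerAr beltM -scalerAl mulrnAl beltM hy mul0rn scaler0.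
rewrite -scalerAr beltM -scalerAl mulrnAl beltM !eqxx /=.
case h : (linked b a); last by rewrite belt_unlinked ?h // !mul0rn !scaler0.
by rewrite /monotone3 /up /dn !eqxx !orTb !andbT -/(up b a) -/(dn b a) -linked_up_dn h.
Qed.

Lemma of_conj (A B : EndVV) : A *m Q = Q *m B -> A = Q *m B *m V.
Proof. by move=> <-; rewrite -mulmxA QV mulmx1. Qed.

End Coefficients.

(** * Identification of A with the algebra of coefficients *)

Section Structure.
Variables (K : fieldType) (n N : nat) (w u : K).
Hypotheses (N2n : N = (2 * n)%N) (N_ge4 : (4 <= N)%N).
Hypotheses (w_prim : N.-primitive_root w) (u_neq0 : u != 0).
Hypothesis uN_neq1 : u ^+ N != 1.
Notation dimN := (Zp_trunc N).+2.
Notation EndVV := 'M[K]_(dimN + dimN).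
Notation Q := (eigenbasis n N w u).
Notation V := (eigenbasisV n N w u).
Notation of_coef := (@of_coef K N Q V).
Notation belt := (@belt K N Q V).

Implicit Types (a b x y z : 'Z_N) (c d : 'M[K]_dimN).

Let VQ : V *m Q = 1%:M. Proof. exact: eigenbasisVK. Qed.

Lemma T_of_coef : T_mx K N = of_coef (char_mx N w).
Proof.
rewrite (of_conj VQ (T_eigen N2n N_ge4 w_prim u_neq0)) /of_coef.
have -> : up_mx (char_mx N w) = char_mx N w.
  by apply/matrixP => i j; rewrite !mxE /up; case: eqP => // _; rewrite mul0rn.
have -> // : dn_mx (char_mx N w) = char_mx N w.
by apply/matrixP => i j; rewrite !mxE /dn; case: eqP => // _; rewrite mul0rn.
Qed.

(** The raising and lowering parts have disjoint supports, so their sum stores both without loss. *)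
Definition coef_Lambda : 'M[K]_dimN := Lambda_up N u + Lambda_dn n N u.

Let upE := Lambda_upE N2n N_ge4 u_neq0 uN_neq1.
Let dnE := Lambda_dnE N2n N_ge4 u_neq0 uN_neq1.

Lemma coef_LambdaE b a : coef_Lambda b a = Lambda_up N u b a + Lambda_dn n N u b a.
Proof. by rewrite mxE. Qed.

Lemma Lambda_of_coef : Lambda_mx N w u = of_coef coef_Lambda.
Proof.
rewrite (of_conj VQ (Lambda_eigen N2n N_ge4 w_prim u_neq0 uN_neq1)) /of_coef.
have -> : up_mx coef_Lambda = Lambda_up N u.
  apply/matrixP => i j; rewrite up_mxE coef_LambdaE upE dnE /up.
  case: (eqVneq i j) => [->|_]; first by rewrite ltnn !andbF addr0.
  by case: (ltngtP (level j) (level i)); rewrite ?andbF ?andbT ?addr0 ?mulr0n.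
have -> // : dn_mx coef_Lambda = Lambda_dn n N u.
apply/matrixP => i j; rewrite dn_mxE coef_LambdaE upE dnE /dn.
case: (eqVneq i j) => [->|_]; first by rewrite ltnn !andbF addr0.
by case: (ltngtP (level j) (level i)); rewrite ?andbF ?andbT ?add0r ?mulr0n.
Qed.

Lemma coef_Lambda_neq0 b a : odd (a + b) -> level a != level b -> coef_Lambda b a != 0.
Proof.
move=> ho hl; rewrite coef_LambdaE upE dnE ho /=.
have q0 : u ^+ N != 0 by rewrite expf_neq0.
case: ltngtP hl => // _ _; rewrite ?addr0 ?add0r.
  by case: ifP; rewrite ?oppr_eq0 oner_neq0.
by do 2!case: ifP => _; rewrite ?oppr_eq0 ?invr_eq0 ?oner_neq0.
Qed.

Definition idem_mx a : EndVV :=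
  N%:R^-1 *: \sum_(0 <= k < N) w ^- (a * k)%N *: T_mx K N ^+ k.

Lemma T_expE k : T_mx K N ^+ k = of_coef (diag_mx (\row_a (zchar w a ^+ k))).
Proof.
elim: k => [|k IH].
  rewrite expr0 -(of_coef1 VQ); congr of_coef; apply/matrixP => i j; rewrite !mxE.
  by case: eqP.
rewrite exprS IH T_of_coef (of_coefM VQ); apply: eq_of_coef => x z h; rewrite !mxE.
rewrite (bigD1 x) //= big1 ?addr0 => [|y /negPf hy]; last first.
  by rewrite !mxE eq_sym hy mul0r mul0rn.
rewrite !mxE eqxx mulr1n /monotone3 /up /dn !eqxx /=.
move: h; rewrite /linked; case: eqP => [->|_ h] /=; first by rewrite !mulr1n exprS.
by rewrite !mulr0n mulr0 mul0rn.
Qed.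

(** By orthogonality of characters this is the spectral projector of T for w^a, the identity on both
    lines over [a]. *)
Lemma idem_mxE a : idem_mx a = belt a a.
Proof.
rewrite /idem_mx /belt big_mkord; under eq_bigr do rewrite T_expE -linearZ.
rewrite -raddf_sum -linearZ; congr of_coef; apply/matrixP => i j; rewrite !mxE summxE.
under eq_bigr do rewrite !mxE.
case: (eqVneq i j) => [<-|ij]; last first.
  rewrite big1 ?mulr0 => [|k _]; last by rewrite mulr0n mulr0.
  by case: eqP => // e; rewrite -e eq_sym (negPf ij).
rewrite (_ : \sum__ _ = \sum_(k : 'Z_N) zchar w (k * (i - a))).
  rewrite (chi_sum N2n N_ge4 w_prim) subr_eq0; case: eqP => _ /=; last by rewrite mulr0.
  by rewrite mulVf // (N_neq0 w_prim).
rewrite -(big_mkord xpredT (fun k => w ^- (a * k) * (zchar w i ^+ k *+ 1%N))).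
rewrite -[X in \sum_(0 <= k < X) _](dimNE N2n N_ge4) big_mkord; apply: eq_bigr => k _.
rewrite mulrBr (chiD N2n N_ge4 w_prim) (chiN N2n N_ge4 w_prim).
by rewrite !(chiM N2n N_ge4 w_prim) mulr1n /zchar -exprM mulrC !(mulnC k).
Qed.

Definition algTL : {aspace EndVV} := <<1 & [:: T_mx K N; Lambda_mx N w u]>>%AS.

Definition coef_space : {vspace EndVV} := limg (linfun of_coef).

Lemma coef_spaceP X : reflect (exists c, X = of_coef c) (X \in coef_space).
Proof.
apply: (iffP memv_imgP) => [[c _ ->]|[c ->]]; first by exists c; rewrite lfunE.
by exists c; rewrite ?memvf // lfunE.
Qed.

Lemma T_in : T_mx K N \in algTL.
Proof. by apply: seqv_sub_adjoin; rewrite inE eqxx. Qed.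
Lemma L_in : Lambda_mx N w u \in algTL.
Proof. by apply: seqv_sub_adjoin; rewrite !inE eqxx orbT. Qed.
Lemma one_in : 1 \in algTL.
Proof. by rewrite memvE sub1_agenv. Qed.

Lemma exp_in k : T_mx K N ^+ k \in algTL.
Proof.
elim: k => [|k IH]; first by rewrite expr0 one_in.
by rewrite exprS memvM ?T_in.
Qed.

Lemma beltaa_in a : belt a a \in algTL.
Proof.
rewrite -idem_mxE /idem_mx memvZ // memv_suml // => k _.
by rewrite memvZ // exp_in.
Qed.

Lemma belt_odd_in b a : odd (a + b) -> level a != level b -> belt b a \in algTL.
Proof.
move=> ho hl; have h0 := coef_Lambda_neq0 ho hl.
have -> : belt b a = (coef_Lambda b a)^-1 *: (belt b b * (Lambda_mx N w u) * belt a a).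
  by rewrite Lambda_of_coef (belt_cut VQ) scalerA mulVf // scale1r.
apply: memvZ; apply: memvM; last exact: beltaa_in.
by apply: memvM; [apply: beltaa_in | apply: L_in].
Qed.

Let level_le := level_le N2n N_ge4.
Let level_natZ := level_natZ N2n N_ge4.
Let odd_level := odd_level N2n N_ge4.

(** Arrows with [a + b] odd are compressions of Lambda. For [a + b] even and distinct levels, the
    levels differ by at least 2; a vertex of level one above the smaller has the other parity and
    lies strictly between, so the arrow is a monotone product of two odd ones. *)
Lemma belt_in b a : belt b a \in algTL.
Proof.
case h : (linked b a); last by rewrite belt_unlinked ?h ?mem0v.
case: (eqVneq b a) => [->|hba]; first exact: beltaa_in.
move: h; rewrite /linked (negPf hba) /= => hl.
case ho : (odd (a + b)); first by rewrite belt_odd_in // eq_sym.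
have ho' : odd (level a) = odd (level b).
  by rewrite !odd_level; move: ho; rewrite oddD; case: odd; case: odd.
pose m := (minn (level a) (level b)).+1; pose y := natZ N m.
have hm : (m < maxn (level a) (level b))%N.
  rewrite /m; move: (level a) (level b) ho' hl => i j hij hl.
  have : i != j.+1 by apply/eqP => e; move: hij; rewrite e /=; case: odd.
  have : j != i.+1 by apply/eqP => e; move: hij; rewrite e /=; case: odd.
  lia.
have ha := level_le a; have hb := level_le b.
have ly : level y = m by apply: level_natZ; lia.
have oy x : odd (level x) = odd (level a) -> odd (x + y).
  move=> h; rewrite oddD -!odd_level h ly /m.
  by rewrite /minn; case: ifP => _ /=; rewrite -?ho'; case: odd.
have -> : belt b a = belt b y * belt y a.
  rewrite (beltM VQ) eqxx /monotone3 /up /dn; move: ly; rewrite /m => ly.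
  have hy1 : (b == y) = false by apply/eqP => e; move: ly; rewrite -e; lia.
  have hy2 : (y == a) = false by apply/eqP => e; move: ly; rewrite e; lia.
  have h : (level y < level b)%N && (level a < level y)%N
      || (level b < level y)%N && (level y < level a)%N.
    by rewrite ly; move: hm; rewrite /m; lia.
  by rewrite hy1 hy2 /= h.
rewrite memvM //; apply: belt_odd_in.
- by rewrite addnC oy.
- lia.
- by rewrite oy.
- lia.
Qed.

Lemma algTL_E : (algTL : {vspace EndVV}) = coef_space.
Proof.
apply/eqP; rewrite eqEsubv; apply/andP; split; last first.
  apply/subvP => x /coef_spaceP[c ->]; rewrite of_coef_sum memv_suml // => b _.
  by rewrite memv_suml // => a _; rewrite memvZ // belt_in.
have h1 : (1 <= coef_space)%VS.
  by rewrite -memvE; apply/coef_spaceP; exists 1%:M; rewrite (of_coef1 VQ).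
(* It remains to see that left multiplication by 1, T and Lambda preserves the space of
   coefficients. *)
apply: agenv_sub_modl => //; apply/prodvP => x y hx /coef_spaceP[d ->].
have /coef_spaceP[c ->] : x \in coef_space.
  move: x hx; apply/subvP; rewrite subv_add h1; apply/span_subvP => x.
  rewrite !inE => /orP[] /eqP->; apply/coef_spaceP.
    by exists (char_mx N w); rewrite T_of_coef.
  by exists coef_Lambda; rewrite Lambda_of_coef.
by apply/coef_spaceP; exists (coef_mul c d); rewrite (of_coefM VQ).
Qed.

Lemma algTLP X : reflect (exists c, X = of_coef c) (X \in algTL).
Proof. by rewrite (_ : (X \in algTL) = (X \in coef_space)) ?algTL_E //; apply: coef_spaceP. Qed.

End Structure.

(** * The center and the corners of A *)

Section CenterCartan.
Variables (K : fieldType) (n N : nat) (w u : K).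
Hypotheses (N2n : N = (2 * n)%N) (N_ge4 : (4 <= N)%N).
Hypotheses (w_prim : N.-primitive_root w) (u_neq0 : u != 0).
Hypothesis uN_neq1 : u ^+ N != 1.
Notation dimN := (Zp_trunc N).+2.
Notation EndVV := 'M[K]_(dimN + dimN).
Notation Q := (eigenbasis n N w u).
Notation V := (eigenbasisV n N w u).
Notation of_coef := (@of_coef K N Q V).
Notation belt := (@belt K N Q V).
Notation to_coef := (@to_coef K N Q V).
Notation A := (algTL N w u).

Implicit Types (a b x y z : 'Z_N) (c d : 'M[K]_dimN).

Let VQ : V *m Q = 1%:M. Proof. exact: eigenbasisVK. Qed.
Let algP := algTLP N2n N_ge4 w_prim u_neq0 uN_neq1.

Lemma belt_in_alg b a : belt b a \in A. Proof. exact: belt_in. Qed.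

Lemma level_eq0 a : (level a == 0%N) = (a == 0).
Proof.
have := ltZN N2n N_ge4 a; rewrite /level -(inj_eq val_inj) /= => h.
by apply/eqP/eqP => [|->]; lia.
Qed.

(** 0 is the only vertex of level 0; its arrows to all other vertices will tie together the diagonal
    entries of a central element. *)
Lemma linked0 b : linked b 0.
Proof.
rewrite /linked -[b == 0]level_eq0; have /eqP-> : level (0 : 'Z_N) == 0%N by rewrite level_eq0.
by case: eqP.
Qed.

Lemma belt_neq0 b a : linked b a -> belt b a != 0.
Proof.
move=> h; apply/eqP => e; have := to_coef_of_coef VQ (delta_mx b a) b a.
rewrite h -/(belt b a) e raddf0 !mxE !eqxx => /esym/eqP.
by rewrite oner_eq0.
Qed.

(** Commuting with the idempotents kills the off-diagonal coefficients, and commuting with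
    [belt b 0] equates the diagonal ones at [b] and 0. *)
Lemma center_algTL : 'Z(A)%VS = 1%VS.
Proof.
apply/eqP; rewrite eqEsubv; apply/andP; split; last first.
  rewrite -memvE memv_cap one_in; apply/centvP => v _; by rewrite mul1r mulr1.
apply/subvP => X; rewrite memv_cap => /andP[/algP[c eX] /centvP cX].
have comX b a := cX _ (belt_in_alg b a).
have EaaE b a y : belt b b * belt y a = belt b a *+ ((b == y) && linked b a).
  rewrite (beltM VQ); congr (_ *+ _); case: (eqVneq b y) => //= e.
  by rewrite linked_up_dn /monotone3 /up /dn !eqxx.
have off b a : linked b a -> b != a -> c b a = 0.
  move=> hok hba; have := belt_cut VQ b a c; rewrite -eX -mulrA comX mulrA EaaE.
  rewrite (negPf hba) mulr0n mul0r => /esym/eqP; rewrite scaler_eq0.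
  by rewrite (negPf (belt_neq0 hok)) orbF => /eqP.
have diag b : c b b = c 0 0.
  have h1 : belt b b * X * belt b 0 = c b b *: belt b 0.
    have -> : belt b 0 = belt b b * belt b 0 by rewrite EaaE eqxx linked0.
    by rewrite mulrA eX (belt_cut VQ) -scalerAl.
  have h2 : belt b 0 * X * belt 0 0 = c 0 0 *: belt b 0.
    have h : belt b 0 = belt b 0 * belt 0 0.
      rewrite (beltM VQ) eqxx /monotone3 /up /dn !eqxx !andbT.
      by rewrite -/(up b 0) -/(dn b 0) -linked_up_dn linked0.
    transitivity (belt b 0 * (belt 0 0 * X * belt 0 0)).
      by rewrite [belt b 0 * (_ * belt 0 0)]mulrA [belt b 0 * (_ * X)]mulrA -h.
    by rewrite eX (belt_cut VQ) -scalerAr -h.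
  have h3 : belt b b * X * belt b 0 = belt b 0 * X * belt 0 0.
    have h : belt b 0 = belt b 0 * belt 0 0.
      rewrite (beltM VQ) eqxx /monotone3 /up /dn !eqxx !andbT.
      by rewrite -/(up b 0) -/(dn b 0) -linked_up_dn linked0.
    rewrite -[LHS]mulrA comX mulrA EaaE eqxx linked0 mulr1n.
    by rewrite -[RHS]mulrA comX mulrA -h.
  have := h3; rewrite h1 h2 => /eqP; rewrite -subr_eq0 -scalerBl scaler_eq0.
  by rewrite (negPf (belt_neq0 (linked0 b))) orbF subr_eq0 => /eqP.
rewrite eX; have -> : of_coef c = of_coef (c 0 0 *: 1%:M).
  apply: eq_of_coef => b a hok; rewrite !mxE; case: (eqVneq b a) => [->|hba].
    by rewrite mulr1 diag.
  by rewrite mulr0 off.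
by rewrite linearZ /= (of_coef1 VQ) memvZ // memv_line.
Qed.

Lemma dim_corner a b :
  \dim (<[idem_mx w a]> * A * <[idem_mx w b]>)%VS = linked a b.
Proof.
rewrite !(idem_mxE N2n N_ge4 w_prim u_neq0 uN_neq1).
have -> : (<[belt a a]> * A * <[belt b b]>)%VS = <[belt a b]>%VS.
  apply/eqP; rewrite eqEsubv; apply/andP; split.
    apply/prodvP => X Y hX /vlineP[k ->].
    have : X \in (amulr (belt b b) @^-1: <[belt a b]>)%VS.
      move: X hX; apply/subvP/prodvP => X Z /vlineP[l ->] /algP[c ->].
      rewrite -memv_preim lfunE /= -!scalerAl (belt_cut VQ).
      by rewrite !memvZ // memv_line.
    by rewrite -memv_preim lfunE /= -scalerAr => h; rewrite memvZ.
  rewrite -memvE; have := belt_cut VQ a b (delta_mx a b); rewrite mxE !eqxx scale1r => <-.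
  by rewrite !memv_mul ?memv_line ?belt_in_alg.
case h : (linked a b); last by rewrite belt_unlinked ?h // dim_vline eqxx.
by rewrite dim_vline belt_neq0.
Qed.

End CenterCartan.

(** * Kernel and rank of the Cartan matrix *)

Section CartanMatrix.
Variables (K : fieldType) (n N : nat).
Hypotheses (N2n : N = (2 * n)%N) (N_ge4 : (4 <= N)%N).
Notation dimN := (Zp_trunc N).+2.
Implicit Types a b : 'Z_N.

Definition linked_mx : 'M[K]_dimN := \matrix_(a, b) (linked (a : 'Z_N) b)%:R.

Lemma eqZE a b : (a == b) = (a == b :> nat). Proof. by []. Qed.

Lemma level_eqE a b : (level a == level b) = (a == b) || (a == - b).
Proof.
have ha := ltZN N2n N_ge4 a; have hb := ltZN N2n N_ge4 b.
rewrite !eqZE (valZN N2n N_ge4) /level.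
move: (a : nat) (b : nat) ha hb => i j ha hb; case: ifP; lia.
Qed.

Lemma linkedE a b : linked a b = (a == b) || (b != - a).
Proof.
rewrite /linked [level a == _]eq_sym level_eqE [b == a]eq_sym.
by case: (a == b); rewrite ?orbT.
Qed.

Lemma val_n : (n%:R : 'Z_N) = n :> nat.
Proof. by rewrite val_Zp_nat; [rewrite modn_small; lia | lia]. Qed.

Lemma eq_opp a : (a == - a) = (a == 0) || (a == n%:R).
Proof.
have ha := ltZN N2n N_ge4 a.
rewrite !eqZE (valZN N2n N_ge4) val_n.
move: (a : nat) ha => i ha; case: ifP; lia.
Qed.

(** Row [a] is constantly 1, except for a 0 in column [- a] when [a] is not its own opposite. *)
Lemma linked_mx_mulE (v : 'cV[K]_dimN) a :
  (linked_mx *m v) a 0 = \sum_b v b 0 - (if a == - a then 0 else v (- a : 'Z_N) 0).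
Proof.
rewrite mxE; apply/eqP; rewrite eq_sym subr_eq; apply/eqP.
rewrite (bigD1 (- a : 'Z_N)) //= [in RHS](bigD1 (- a : 'Z_N)) //=.
rewrite -addrA [X in _ = _ + X]addrC addrA mxE linkedE eqxx orbF; congr (_ + _).
  by case: eqP => _; rewrite ?mul1r ?addr0 ?mul0r ?add0r.
by apply: eq_bigr => b hb; rewrite mxE linkedE hb orbT mul1r.
Qed.

(** Row 0 says that the entries of v sum to 0; then row [- a] gives [v a 0 = 0] unless [a] is 0 or
    n, and only two opposite entries remain. *)
Lemma linked_mx_ker (v : 'cV[K]_dimN) : linked_mx *m v = 0 <->
  exists k : K, v = k *: (delta_mx (0 : 'Z_N) 0 - delta_mx (n%:R : 'Z_N) 0).
Proof.
have n0 : (n%:R == 0 :> 'Z_N) = false.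
  by rewrite -(inj_eq val_inj) /= val_n; lia.
split => [h | [k ->]].
  have hS : \sum_b v b 0 = 0.
    have := linked_mx_mulE v 0; rewrite h mxE oppr0 eqxx subr0 => <-. by [].
  have hv a : a != 0 -> a != n%:R -> v a 0 = 0.
    move=> a0 an; have := linked_mx_mulE v (- a); rewrite h hS mxE opprK eq_sym eq_opp.
    by rewrite (negPf a0) (negPf an) /= sub0r => /eqP; rewrite eq_sym oppr_eq0 => /eqP.
  exists (v 0 0); apply/colP => a; rewrite !mxE eqxx !andbT.
  case: (eqVneq a 0) => [->|a0]; first by rewrite eq_sym n0 subr0 mulr1.
  case: (eqVneq a n%:R) => [->|an]; last by rewrite hv // subr0 mulr0.
  rewrite sub0r mulrN1; apply/eqP; rewrite -addr_eq0 addrC; apply/eqP.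
  move: hS; rewrite (bigD1 (0 : 'Z_N)) //= (bigD1 (n%:R : 'Z_N)) ?n0 //=.
  rewrite big1 ?addr0 => [|b /andP[b0 bn]]; by [|apply: hv].
set d : 'cV[K]_dimN := delta_mx _ _ - _.
apply/colP => a; rewrite linked_mx_mulE [RHS]mxE.
have -> : \sum_b (k *: d) b 0 = 0.
  rewrite (bigD1 (0 : 'Z_N)) //= (bigD1 (n%:R : 'Z_N)) ?n0 //=.
  rewrite big1 ?addr0 => [|b /andP[b0 bn]].
    by rewrite !mxE !eqxx n0 eq_sym n0 /=; ring.
  by rewrite !mxE (negPf b0) (negPf bn) subrr mulr0.
case: eqP => [_|/eqP h]; first by rewrite subr0.
have := h; rewrite eq_opp negb_or => /andP[a0 an].
have hn : (- a == n%:R) = false.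
  have : (n%:R : 'Z_N) = - n%:R by apply/eqP; rewrite eq_opp eqxx orbT.
  by move=> {1}->; rewrite (inj_eq oppr_inj) (negPf an).
by rewrite !mxE oppr_eq0 (negPf a0) hn /= subrr mulr0 subr0.
Qed.

(** Rank-nullity; [kermx] is a left kernel, hence the transposes. *)
Lemma linked_mx_rank : \rank linked_mx = (N - 1)%N.
Proof.
pose r : 'rV[K]_dimN := (delta_mx (0 : 'Z_N) 0 - delta_mx (n%:R : 'Z_N) 0)^T.
have n0 : (n%:R == 0 :> 'Z_N) = false.
  by rewrite -(inj_eq val_inj) /= val_n; lia.
have r0 : r != 0.
  apply/eqP => /rowP/(_ 0); rewrite !mxE !eqxx eq_sym n0 subr0 => /eqP.
  by rewrite oner_eq0.
have kr : (kermx linked_mx^T :=: r)%MS.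
  apply/eqmxP/andP; split; last first.
    apply/sub_kermxP; apply: trmx_inj; rewrite trmx_mul !trmxK trmx0.
    by apply/linked_mx_ker; exists 1; rewrite scale1r.
  apply/row_subP => i; have /sub_kermxP := row_sub i (kermx linked_mx^T).
  move/(congr1 trmx); rewrite trmx_mul trmxK trmx0 => /linked_mx_ker[k e].
  apply/sub_rVP; exists k; apply: trmx_inj; rewrite e linearZ /= trmxK. by [].
have := mxrank_ker linked_mx^T; rewrite kr mxrank_tr rank_rV r0 => e.
have := rank_leq_row linked_mx; have := dimNE N2n N_ge4; lia.
Qed.

End CartanMatrix.

(** * Modules given by matrix representations *)

Section MatrixModules.
Variables (K : fieldType) (A : nzRingType) (k : nat) (r : A -> 'M[K]_k).

Record matrix_rep : Prop := MatrixRep {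
  rep_add : {morph r : x y / x + y};
  rep_one : r 1 = 1%:M;
  rep_mul : forall x y, r (x * y) = r x *m r y }.

(** The representation is a phantom argument, so that the same column space can carry different
    module structures. *)
Definition repmod of matrix_rep : Type := 'cV[K]_k.

Variable h : matrix_rep.

HB.instance Definition _ := GRing.Zmodule.on (repmod h).

Fact repmod_scaleA (x y : A) (v : repmod h) :
  r x *m (r y *m v) = r (x * y) *m v :> 'cV[K]_k.
Proof. by rewrite (rep_mul h) mulmxA. Qed.
Fact repmod_scale1 (v : repmod h) : r 1 *m v = v :> 'cV[K]_k.
Proof. by rewrite (rep_one h) mul1mx. Qed.
Fact repmod_scaleDr (x : A) (v v' : repmod h) :
  r x *m (v + v' : 'cV[K]_k) = r x *m v + r x *m v' :> 'cV[K]_k.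
Proof. by rewrite mulmxDr. Qed.
Fact repmod_scaleDl (v : repmod h) (x y : A) :
  r (x + y) *m v = r x *m v + r y *m v :> 'cV[K]_k.
Proof. by rewrite (rep_add h) mulmxDl. Qed.

HB.instance Definition _ := GRing.Zmodule_isLmodule.Build A (repmod h)
  repmod_scaleA repmod_scale1 (fun a v w => repmod_scaleDr a v w)
  (fun v a b => repmod_scaleDl v a b).

Lemma repmod_scaleE (x : A) (v : repmod h) : x *: v = r x *m v :> 'cV[K]_k.
Proof. by []. Qed.

End MatrixModules.

(** Packs a function proved linear within a proof as a bundled linear map. *)
Lemma linear_ext (A : nzRingType) (U V : lmodType A) (f : U -> V) :
  linear f -> exists g : {linear U -> V}, g =1 f.
Proof.
move=> fl; pose m := GRing.isLinear.Build A U V _ f fl.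
by exists (HB.pack f m : {linear U -> V}).
Qed.

(** * Representations of A read off from coefficients *)

Section Reps.
Variables (K : fieldType) (n N : nat) (w u : K).
Hypotheses (N2n : N = (2 * n)%N) (N_ge4 : (4 <= N)%N).
Hypotheses (w_prim : N.-primitive_root w) (u_neq0 : u != 0).
Hypothesis uN_neq1 : u ^+ N != 1.
Notation dimN := (Zp_trunc N).+2.
Notation EndVV := 'M[K]_(dimN + dimN).
Notation Q := (eigenbasis n N w u).
Notation V := (eigenbasisV n N w u).
Notation of_coef := (@of_coef K N Q V).
Notation belt := (@belt K N Q V).
Notation to_coef := (@to_coef K N Q V).
Notation A := (algTL N w u).
Notation SA := (subvs_of A).

Implicit Types (a b c d z : 'Z_N) (x y : SA).

Let VQ : V *m Q = 1%:M. Proof. exact: eigenbasisVK. Qed.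
Let algP := algTLP N2n N_ge4 w_prim u_neq0 uN_neq1.

Lemma val_one : vsval (1 : SA) = 1.
Proof. by apply/eqP; rewrite algid_eq1 one_in. Qed.

Definition coefA b a (x : SA) : K := to_coef (vsval x) b a.

Lemma coefAD b a x y : coefA b a (x + y) = coefA b a x + coefA b a y.
Proof. by rewrite /coefA !raddfD /= mxE. Qed.

Lemma coefAZ b a (k : K) x : coefA b a (k *: x) = k * coefA b a x.
Proof. by rewrite /coefA (_ : vsval (k *: x) = k *: vsval x) // linearZ mxE. Qed.

Lemma coefA1 b a : coefA b a 1 = (b == a)%:R.
Proof.
rewrite /coefA val_one -(of_coef1 VQ) (to_coef_of_coef VQ) mxE /linked.
by case: eqP; rewrite ?mul0rn.
Qed.

Lemma val_of_coef (x : SA) : vsval x = of_coef (to_coef (vsval x)).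
Proof. by have /algP[c e] := subvsP x; rewrite e (of_coefK VQ). Qed.

Lemma coefAM c a x y :
  coefA c a (x * y) = \sum_z (coefA c z x * coefA z a y *+ monotone3 c z a) *+ linked c a.
Proof.
rewrite /coefA (_ : vsval (x * y) = vsval x * vsval y) // [in LHS](val_of_coef x).
by rewrite [in LHS](val_of_coef y) (of_coefM VQ) (to_coef_of_coef VQ) mxE -sumrMnl.
Qed.

(** A level-monotone loop is constant, so each diagonal coefficient is a character of A; it defines
    the simple module S_a. *)
Lemma coefAM_diag a x y : coefA a a (x * y) = coefA a a x * coefA a a y.
Proof.
rewrite coefAM (bigD1 a) //= big1 ?addr0 => [|z /negPf hz].
  by rewrite /monotone3 /up /linked !eqxx.
rewrite /monotone3 /up /dn [a == z]eq_sym hz /=.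
by case: ltngtP; rewrite ?mulr0n ?mul0rn.
Qed.

Definition adj c a := (level c == (level a).+1) || (level a == (level c).+1).

Lemma coefAM_adj c a x y : adj c a ->
  coefA c a (x * y) = coefA c c x * coefA c a y + coefA c a x * coefA a a y.
Proof.
move=> hca; have ca : c != a by apply/eqP => e; move: hca; rewrite /adj e; lia.
have hok : linked c a by rewrite /linked; move: hca; rewrite /adj; lia.
rewrite coefAM (bigD1 c) //= (bigD1 a) 1?eq_sym //=.
rewrite big1 ?addr0 => [|z /andP[/negPf zc /negPf za]].
  rewrite hok /monotone3.
  have hok' : up c a || dn c a by rewrite -linked_up_dn.
  have huxx z : up z z && dn z z by rewrite /up /dn eqxx.
  by case/andP: (huxx a) => -> ->; case/andP: (huxx c) => -> ->; rewrite /= !andbT hok' !mulr1n.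
rewrite /monotone3 /up /dn [c == z]eq_sym zc za /=.
by case: (_ || _) / idP; rewrite ?mulr0n ?mul0rn //; move: hca; rewrite /adj; lia.
Qed.

Definition sbelt b a : SA := Subvs (belt_in_alg N2n N_ge4 w_prim u_neq0 uN_neq1 b a).

Lemma coef_sbelt b a c d : coefA b a (sbelt c d) = ((b == c) && (a == d))%:R *+ linked b a.
Proof. by rewrite /coefA /= (to_coef_of_coef VQ) mxE. Qed.

Lemma sbeltM b a c d : sbelt b a * sbelt c d = sbelt b d *+ ((a == c) && monotone3 b a d).
Proof.
apply: val_inj; rewrite [LHS](_ : _ = belt b a * belt c d) // (beltM VQ).
by case: (_ && _).
Qed.

(* Between vertices of adjacent levels no path factors through a third vertex,
   so the coefficient is a derivation with respect to the two diagonal ones: a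
   weight matrix g without two-step products gives a matrix representation. *)
Section Rho.
Variables (k : nat) (v : 'I_k -> 'Z_N) (g : 'M[K]_k).
Hypothesis g1 : forall i, g i i = 1.
Hypothesis g_adj : forall i j, i != j -> g i j != 0 -> adj (v i) (v j).
Hypothesis g2 : forall i j l, i != j -> j != l -> g i j * g j l = 0.

Definition rho (x : SA) : 'M[K]_k := \matrix_(i, j) (g i j * coefA (v i) (v j) x).

Lemma rho_rep : matrix_rep rho.
Proof.
split=> [x y||x y]; apply/matrixP => i j.
- by rewrite !mxE coefAD mulrDr.
- rewrite !mxE coefA1; case: (eqVneq i j) => [->|ij]; first by rewrite g1 eqxx mul1r.
  case: (eqVneq (g i j) 0) => [->|hg]; first by rewrite mul0r.
  have := g_adj ij hg; case: eqVneq => [->|_ _]; last by rewrite mulr0.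
  by rewrite /adj; lia.
rewrite !mxE; under eq_bigr do rewrite !mxE.
case: (eqVneq i j) => [<-|ij].
  rewrite (bigD1 i) //= big1 ?addr0; first by rewrite g1 !mul1r coefAM_diag.
  by move=> l hl; rewrite mulrACA g2 ?mul0r // eq_sym.
rewrite (bigD1 i) //= (bigD1 j) 1?eq_sym //= big1 ?addr0; last first.
  by move=> l /andP[hi hj]; rewrite mulrACA g2 ?mul0r // eq_sym.
rewrite !g1 !mul1r.
case: (eqVneq (g i j) 0) => [->|hg]; first by rewrite !mul0r !mulr0 addr0.
by rewrite (coefAM_adj _ _ (g_adj ij hg)); ring.
Qed.

Lemma rho_sbelt i j : injective v -> rho (sbelt (v i) (v j)) = g i j *: delta_mx i j.
Proof.
move=> vI; apply/matrixP => i' j'; rewrite !mxE coef_sbelt !(inj_eq vI).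
case: eqP => [->|_]; last by rewrite mul0rn !mulr0.
case: eqP => [->|_]; last by rewrite mul0rn !mulr0.
case: (eqVneq (g i j) 0) => [->|hg]; first by rewrite !mul0r.
rewrite /linked; case: (eqVneq i j) => [->|hij]; first by rewrite eqxx.
have := g_adj hij hg; rewrite /adj => ha.
by rewrite (_ : level (v i) != level (v j)) ?orbT //; move: ha; lia.
Qed.

Fact rho_is_linear : linear rho.
Proof.
by move=> k' x y; apply/matrixP => i j; rewrite !mxE coefAD coefAZ mulrDr mulrCA.
Qed.
HB.instance Definition _ := GRing.isLinear.Build K SA 'M[K]_k _ rho rho_is_linear.

End Rho.

(** * Infinite global dimension *)

Section GlobalDimension.

(* A functional a P F is an A-linear map from P to the simple module S_a. *)
Definition functional a (P : lmodType SA) (F : P -> K) : Prop :=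
  {morph F : p q / p + q} /\ forall (x : SA) (p : P), F (x *: p) = coefA a a x * F p.

Lemma simple_rep a : matrix_rep (rho (fun _ : 'I_1 => a) (const_mx 1)).
Proof. by apply: rho_rep => [i|i j|i j l]; rewrite ?mxE // !ord1 eqxx. Qed.

(** Data of the extension of S_a (coordinate 1, the quotient) by S_c (coordinate 0, the submodule)
    on which the arrow from a to c acts by 1. *)
Definition edge_vertex c a (i : 'I_2) : 'Z_N := if i == 0 then c else a.
Definition edge_coef : 'M[K]_2 := \matrix_(i, j) (i <= j)%:R.

Lemma edge_rep c a : adj c a -> matrix_rep (rho (edge_vertex c a) edge_coef).
Proof.
move=> hca; apply: rho_rep => [i|i j|i j l]; rewrite !mxE ?leqnn //.
  by case: i j => [[|[|//]] ?] [[|[|//]] ?] //= _; rewrite eqxx.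
by case: i j l => [[|[|//]] ?] [[|[|//]] ?] [[|[|//]] ?] //= _ _; rewrite ?mulr0 ?mul0r.
Qed.

(* If P' -> P is part of a projective resolution of M, then F represents a class
   in Ext^i(M, S_a), and F' its Yoneda product with the extension of S_a by S_c
   given by the arrow from a to c. *)
Lemma functional_step c a (P P' : lmodType SA) (d : {linear P' -> P}) (F : P -> K) :
  adj c a -> projective P -> functional a F -> (forall p', F (d p') = 0) ->
  exists F' : P' -> K, [/\ functional c F',
    forall p p', d p' = sbelt c a *: p -> F' p' = F p
    & forall p', d p' = 0 -> F' p' = 0].
Proof.
move=> hca projP [FD FZ] Fd.
have hok : linked c a by rewrite /linked; move: (hca); rewrite /adj; lia.
have ca : (c == a) = false by apply/eqP => e; move: (hca); rewrite /adj e; lia.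
pose S := repmod (simple_rep a); pose U := repmod (edge_rep hca).
have [f fE] : exists f : {linear P -> S}, f =1 fun p => (\col__ F p : 'cV[K]_1).
  apply: linear_ext => x p q; apply/colP => i.
  by rewrite repmod_scaleE !mxE big_ord1 !mxE FD FZ mul1r.
have [g gE] : exists g : {linear U -> S}, g =1 fun v => (\col__ (v : 'cV[K]_2) 1 0 : 'cV[K]_1).
  apply: linear_ext => x v v'; apply/colP => i.
  rewrite !repmod_scaleE !mxE big_ord1 !big_ord_recl big_ord0 !mxE /=.
  rewrite (_ : lift ord0 ord0 = 1 :> 'I_2); last exact: val_inj.
  by rewrite !mul0r add0r addr0 /edge_vertex.
have gsurj : surj g.
  move=> y; exists (\col__ (y : 'cV[K]_1) 0 0 : 'cV[K]_2).
  by rewrite gE; apply/colP => i; rewrite !mxE ord1.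
(* [F], seen as a map to S_a, lifts through the extension [U] because [P] is projective. *)
have [h hE] := projP _ _ g f gsurj.
have h1 p : (h p : 'cV[K]_2) 1 0 = F p.
  by have := hE p; rewrite gE fE => /colP/(_ 0); rewrite !mxE.
have hZ x p : (h (x *: p) : 'cV[K]_2) 0 0
    = coefA c c x * (h p : 'cV[K]_2) 0 0 + coefA c a x * F p.
  rewrite linearZ_LR repmod_scaleE mxE !big_ord_recl big_ord0 !mxE /= addr0 !mul1r.
  by congr (_ + _ * _); rewrite -h1; congr ((h p : 'cV[K]_2) _ _); apply: val_inj.
(* On the image of [d] the S_a-coordinate [F] vanishes, so there the S_c-coordinate of the lift is
   A-linear. *)
exists (fun p' => (h (d p') : 'cV[K]_2) 0 0); split.
- split=> [p q|x p]; first by rewrite !linearD mxE.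
  by rewrite linearZ_LR hZ Fd mulr0 addr0.
- move=> p p' ->; rewrite hZ !coef_sbelt eqxx /=.
  by rewrite ca eqxx hok mul0rn mul0r add0r mul1r.
- by move=> p' ->; rewrite linear0 mxE.
Qed.

Definition alt_vertex (i : nat) : 'Z_N := natZ N (odd i).

Lemma level_alt i : level (alt_vertex i) = odd i.
Proof. by rewrite /alt_vertex (level_natZ N2n N_ge4) //; case: odd => //; lia. Qed.

Lemma adj_alt i : adj (alt_vertex i.+1) (alt_vertex i).
Proof. by rewrite /adj !level_alt /=; case: odd. Qed.

Lemma alt_neq i : (alt_vertex i.+1 == alt_vertex i) = false.
Proof.
by apply/eqP => e; have := level_alt i.+1; rewrite e level_alt /=; case: odd.
Qed.

Definition alt_arrow i := sbelt (alt_vertex i.+1) (alt_vertex i).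

(** The path goes from one of the vertices 0, 1 to the other and back, so the level is not
    monotone. *)
Lemma alt_arrowM i : alt_arrow i.+1 * alt_arrow i = 0.
Proof.
by rewrite /alt_arrow sbeltM eqxx /monotone3 /up /dn !alt_neq !level_alt /=; case: odd.
Qed.

Lemma gldim_algTL : gldim_infinite SA.
Proof.
move=> m /(_ (repmod (simple_rep (alt_vertex 0)))).
move=> [P [d [aug [projP aug_surj ex0 ex bound]]]].
(* [F] is a cocycle of degree [i] and [p] a witness that it is nonzero; the preimage [q] of the
   arrow times [p] provides the next witness. *)
pose inv i := exists p F, [/\ functional (alt_vertex i) F, F p = 1,
  forall q, F (d i q) = 0 & exists q, d i q = alt_arrow i *: p].
have inv_all i : inv i.
  elim: i => [|i [p [F [fF Fp Fd [q dq]]]]].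
    have [p hp] := aug_surj (const_mx 1 : 'cV[K]_1).
    exists p, (fun p => (aug p : 'cV[K]_1) 0 0); split.
    - split=> [x y|x y]; first by rewrite linearD mxE.
      by rewrite linearZ_LR repmod_scaleE mxE big_ord1 !mxE mul1r.
    - by rewrite hp mxE.
    - move=> q; have -> : aug (d 0%N q) = 0 by apply/ex0; exists q.
      by rewrite mxE.
    (* The arrow joins distinct vertices, so it kills S_0; by exactness the arrow times [p] lifts to
       P_1. *)
    apply/ex0; rewrite linearZ_LR hp repmod_scaleE; apply/colP => j.
    by rewrite !mxE big_ord1 !mxE coef_sbelt [alt_vertex 0 == _]eq_sym alt_neq mul0rn mulr0 mul0r.
  have [F' [fF' F'1 F'0]] := functional_step (adj_alt i) (projP i) fF Fd.
  have dd (y : P i.+2) : d i (d i.+1 y) = 0 by apply/ex; exists y.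
  exists q, F'; split=> //.
  - by rewrite (F'1 p).
  - by move=> y; apply: F'0.
  (* Consecutive arrows compose to 0, so the next arrow times [q] is a cycle, hence a boundary. *)
  by apply/ex; rewrite linearZ_LR dq scalerA alt_arrowM scale0r.
have [p [F [[_ FZ] Fp _ _]]] := inv_all m.+1.
(* P_(m+1) is zero, which forces [F p = 0] against [F p = 1]. *)
move: Fp; rewrite (bound _ (ltnSn m) p) -(scale0r (0 : P m.+1)) FZ.
by rewrite /coefA (_ : vsval 0 = 0) // raddf0 mxE mul0r => /eqP; rewrite eq_sym oner_eq0.
Qed.

End GlobalDimension.

(** * Infinitely many indecomposables on four vertices *)

Section FourVertices.

Hypothesis K_char0 : injective (fun i : nat => i%:R : K).

(* Positions 0, 1 hold the vertices 0, 2 and positions 2, 3 the vertices 1, -1. *)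
Definition vertex4 (i : 'I_4) : 'Z_N := natZ N (nth 0%N [:: 0; 2; 1; N.-1] i)%N.

Lemma val_vertex4 i : vertex4 i = nth 0%N [:: 0; 2; 1; N.-1]%N i :> nat.
Proof.
by apply: (val_natZ N2n N_ge4); case: i => [[|[|[|[|//]]]] ?] /=; lia.
Qed.

Lemma vertex4_inj : injective vertex4.
Proof.
move=> i j /(congr1 (@nat_of_ord _)); rewrite !val_vertex4 => e; apply: val_inj => /=.
by move: e; case: i j => [[|[|[|[|//]]]] ?] [[|[|[|[|//]]]] ?] //=; lia.
Qed.

Lemma level_vertex4 i : level (vertex4 i) = nth 0%N [:: 0; 2; 1; 1]%N i.
Proof.
rewrite /level val_vertex4; case: i => [[|[|[|[|//]]]] ?] /=; lia.
Qed.

(** The row [i] is the target: arrows lead from level 1 (positions 2, 3) to levels 0 and 2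
    (positions 0, 1). *)
Definition arrow4 (i j : 'I_4) := (i < 2)%N && (1 < j)%N.

Lemma adj_vertex4 i j : arrow4 i j -> adj (vertex4 i) (vertex4 j).
Proof.
rewrite /adj !level_vertex4.
by case: i j => [[|[|[|[|//]]]] ?] [[|[|[|[|//]]]] ?].
Qed.

(** The four arrows form a cycle of the underlying graph, so the weight [k] on one of them cannot be
    removed by rescaling the basis. *)
Definition coef4 (k : K) : 'M[K]_4 := \matrix_(i, j)
  if i == j then 1 else
  if arrow4 i j then (if (i == 0%N :> nat) && (j == 2%N :> nat) then k else 1) else 0.

Lemma rep4 k : matrix_rep (rho vertex4 (coef4 k)).
Proof.
apply: rho_rep => [i|i j|i j l]; rewrite !mxE ?eqxx //.
  by move=> /negPf->; case h : (arrow4 i j); [move=> _; apply: adj_vertex4 | rewrite eqxx].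
move=> /negPf-> /negPf->; rewrite /arrow4.
by case: (ltnP j 2) => hj; rewrite ?andbF ?mulr0 ?mul0r // ltnNge hj /= mulr0.
Qed.

Definition mod4 k : lmodType SA := repmod (rep4 k).

Lemma mod4_scaleE k (x : SA) (v : mod4 k) :
  x *: v = rho vertex4 (coef4 k) x *m (v : 'cV[K]_4) :> 'cV[K]_4.
Proof. by []. Qed.

Lemma mod4_scalar k (c : K) (v : mod4 k) :
  c%:A *: v = c *: (v : 'cV[K]_4) :> 'cV[K]_4.
Proof.
rewrite mod4_scaleE -mul_scalar_mx -scalemx1 -(rep_one (rep4 k)).
by congr (_ *m _); apply/matrixP => i j; rewrite !mxE coefAZ mulrCA.
Qed.

Lemma rho_vertex4 k i j :
  rho vertex4 (coef4 k) (sbelt (vertex4 i) (vertex4 j)) = coef4 k i j *: delta_mx i j.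
Proof.
apply: rho_sbelt vertex4_inj => i' j'; rewrite !mxE => /negPf->.
by case h : (arrow4 i' j'); [move=> _; apply: adj_vertex4 | rewrite eqxx].
Qed.

Lemma mod4_arrow k i j :
  (sbelt (vertex4 i) (vertex4 j) : SA) *: (delta_mx j 0 : mod4 k)
    = coef4 k i j *: delta_mx i 0 :> 'cV[K]_4.
Proof. by rewrite mod4_scaleE rho_vertex4 -scalemxAl mul_delta_mx. Qed.

Lemma mod4_decomp k (v : mod4 k) :
  v = \sum_i ((v : 'cV[K]_4) i 0)%:A *: (delta_mx i 0 : mod4 k).
Proof.
rewrite [LHS](matrix_sum_delta (v : 'cV[K]_4)); apply: eq_bigr => i _.
by rewrite big_ord1 [RHS]mod4_scalar.
Qed.

Lemma mod4_findim k : findim_module (mod4 k).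
Proof.
exists 4%N, (fun i => delta_mx i 0) => x.
by exists (fun i => (x : 'cV[K]_4) i 0); apply: mod4_decomp.
Qed.

(** Commuting with the four idempotents makes [f] diagonal. The three arrows of weight 1 equate its
    diagonal entries, and the fourth gives [k * a = l * a]. *)
Lemma mod4_hom k l (f : {linear mod4 k -> mod4 l}) :
  exists a : K, (forall v, f v = a *: (v : 'cV[K]_4) :> 'cV[K]_4) /\ k * a = l * a.
Proof.
pose a i := (f (delta_mx i 0) : 'cV[K]_4) i 0.
have fZ (x : SA) v : f (x *: v) = x *: f v by rewrite linearZ_LR.
have fc (c : K) (v : mod4 k) :
    f (c *: (v : 'cV[K]_4) : 'cV[K]_4) = c *: (f v : 'cV[K]_4) :> 'cV[K]_4.
  by rewrite -mod4_scalar -[RHS]mod4_scalar fZ.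
have c1 k' i : coef4 k' i i = 1 by rewrite mxE eqxx.
have fd i : f (delta_mx i 0) = a i *: delta_mx i 0 :> 'cV[K]_4.
  have := fZ (sbelt (vertex4 i) (vertex4 i)) (delta_mx i 0).
  rewrite [in LHS]mod4_arrow c1 scale1r => ->.
  rewrite mod4_scaleE rho_vertex4 c1 scale1r; apply/colP => i'.
  rewrite !mxE (bigD1 i) //= big1 ?addr0.
    by rewrite !mxE !eqxx !andbT mulrC.
  by move=> m /negPf hm; rewrite !mxE hm andbF mul0r.
have rel i j : coef4 k i j * a i = coef4 l i j * a j.
  have := fZ (sbelt (vertex4 i) (vertex4 j)) (delta_mx j 0).
  rewrite [in LHS]mod4_arrow fc fd mod4_scaleE fd rho_vertex4.
  rewrite -scalemxAr -scalemxAl mul_delta_mx !scalerA => /colP/(_ i).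
  by rewrite !mxE !eqxx !mulr1 => ->; rewrite mulrC.
pose o i (hi : (i < 4)%N) : 'I_4 := Ordinal hi.
have r02 := rel (o 0%N isT) (o 2%N isT).
have r03 := rel (o 0%N isT) (o 3%N isT).
have r12 := rel (o 1%N isT) (o 2%N isT).
have r13 := rel (o 1%N isT) (o 3%N isT).
rewrite !mxE /= in r02 r03 r12 r13; rewrite !mul1r in r03 r12 r13.
exists (a (o 3%N isT)); split; last by rewrite -{1}r03 r02 -r12 r13.
have aE i : a i = a (o 3%N isT).
  case: i => [[|[|[|[|//]]]] hi]; [rewrite -r03 | rewrite -r13 | rewrite -r13 r12 |];
  by congr (a _); apply: val_inj.
move=> v; rewrite {1}(mod4_decomp v) linear_sum.
rewrite [in RHS](matrix_sum_delta (v : 'cV[K]_4)) scaler_sumr.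
apply: eq_bigr => i _; rewrite big_ord1 fZ.
by rewrite [LHS]mod4_scalar fd !scalerA aE mulrC.
Qed.

Lemma mod4_neq0 k : ~ zero_module (mod4 k).
Proof.
move=> /(_ (const_mx 1 : 'cV[K]_4)) /colP/(_ 0); rewrite !mxE => /eqP.
by rewrite oner_eq0.
Qed.

(** The projector onto a direct summand is an idempotent endomorphism, hence the scalar 0 or 1. *)
Lemma mod4_indecomposable k : indecomposable (mod4 k).
Proof.
split=> [|U U' [f [g fK gK]]]; first exact: mod4_neq0.
have [e eE] : exists e : {linear mod4 k -> mod4 k}, e =1 fun v => g ((f v).1, 0).
  apply: linear_ext => x v v'; apply: (can_inj fK).
  by rewrite gK !linearP !gK [RHS]surjective_pairing /= scaler0 addr0.
have [a [ea _]] := mod4_hom e.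
have ee v : e (e v) = e v by rewrite !eE gK.
have : a * a = a.
  have := ee (const_mx 1 : 'cV[K]_4); rewrite ea ea => /colP/(_ 0).
  by rewrite !mxE !mulr1.
move/eqP; rewrite -subr_eq0 -[X in _ - X]mulr1 -mulrBr mulf_eq0 subr_eq0.
case/orP=> /eqP a01; [left=> x | right=> x].
  have h : e (g (x, 0)) = g (x, 0) by rewrite eE gK.
  have h0 : g (x, 0) = 0 by rewrite -h ea a01 scale0r.
  by have := gK (x, 0); rewrite h0 linear0 => -[].
have h : e (g (0, x)) = g (0, 0) by rewrite eE gK.
have := ea (g (0, x)); rewrite a01 scale1r h => /(can_inj gK) [].
by [].
Qed.

Lemma mod4_iso k l : module_iso (mod4 k) (mod4 l) -> k = l.
Proof.
move=> [f fbij]; have [a [fa kl]] := mod4_hom f.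
have a0 : a != 0.
  apply/eqP => a0; apply: (@mod4_neq0 k) => v; apply: (bij_inj fbij).
  by rewrite linear0 fa a0 scale0r.
exact: mulIf kl.
Qed.

Lemma infinite_rep_algTL : infinite_rep_type SA.
Proof.
exists (fun i => mod4 i%:R); split=> [i|i j /mod4_iso /K_char0 //].
by split; [exact: mod4_findim | exact: mod4_indecomposable].
Qed.

End FourVertices.

End Reps.

(** * The path algebra quotient *)

Section PathQuotient.
Variables (K : fieldType) (n N : nat) (w u : K).
Hypotheses (N2n : N = (2 * n)%N) (N_ge4 : (4 <= N)%N).
Hypotheses (w_prim : N.-primitive_root w) (u_neq0 : u != 0).
Hypothesis uN_neq1 : u ^+ N != 1.
Notation A := (algTL N w u).
Notation SA := (subvs_of A).

(** With all weights 1, the image is spanned by the matrix units on the diagonal and at the places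
    of [arrow4]. *)
Definition rho4 : SA -> 'M[K]_4 := rho n (vertex4 N) (coef4 1).
HB.instance Definition _ := GRing.Linear.on rho4.

Lemma rho4_rep : matrix_rep rho4. Proof. exact: rep4. Qed.

Definition im4 : {vspace 'M[K]_4} := limg (linfun rho4).

Lemma im4P X : reflect (exists x, X = rho4 x) (X \in im4).
Proof.
apply: (iffP memv_imgP) => [[x _ ->]|[x ->]]; first by exists x; rewrite lfunE.
by exists x; rewrite ?memvf // lfunE.
Qed.

Lemma im4_one : 1 \in im4.
Proof. by apply/im4P; exists 1; rewrite (rep_one rho4_rep). Qed.

Fact im4_aspace : is_aspace im4.
Proof.
rewrite /is_aspace has_algid1 ?im4_one //; apply/prodvP => X Y /im4P[x ->] /im4P[y ->].
by apply/im4P; exists (x * y); rewrite (rep_mul rho4_rep).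
Qed.

Definition B4 : {aspace 'M[K]_4} := ASpace im4_aspace.

Definition toB (x : SA) : subvs_of B4 := vsproj B4 (rho4 x).

Lemma toBK x : vsval (toB x) = rho4 x.
Proof. by rewrite vsprojK //; apply/im4P; exists x. Qed.

Fact toB_is_linear : linear toB.
Proof. by move=> k x y; apply: val_inj; rewrite /= !toBK linearP. Qed.
HB.instance Definition _ := GRing.isLinear.Build K SA (subvs_of B4) _ toB toB_is_linear.

Fact toB_is_monoid_morphism : monoid_morphism toB.
Proof.
split=> [|x y]; apply: val_inj; rewrite /= !toBK.
  rewrite (rep_one rho4_rep); apply/esym/eqP.
  by rewrite (algid_eq1 B4); apply: im4_one.
by rewrite (rep_mul rho4_rep).
Qed.
HB.instance Definition _ :=
  GRing.isMonoidMorphism.Build SA (subvs_of B4) toB toB_is_monoid_morphism.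

Definition vertex_index (v : vertex quiver22) : 'I_4 := unsplit v.

Lemma vertex_index_inj : injective vertex_index. Proof. exact: can_inj (@unsplitK 2 2). Qed.

Lemma delta_im4 i j : (i == j) || arrow4 i j -> delta_mx i j \in im4.
Proof.
move=> h; apply/im4P.
exists (sbelt N2n N_ge4 w_prim u_neq0 uN_neq1 (vertex4 N i) (vertex4 N j)).
rewrite /rho4 rho_vertex4 mxE; case: (eqVneq i j) h => [_ _|_ /= ->]; rewrite ?scale1r //.
by case: ifP => _; rewrite scale1r.
Qed.

Lemma im4_zero X i j : X \in im4 -> i != j -> ~~ arrow4 i j -> X i j = 0.
Proof.
by move=> /im4P[x ->] /negPf ij /negPf h; rewrite mxE mxE ij h mul0r.
Qed.

Definition arrow_path (a : arrow quiver22) : qpath quiver22 :=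
  exist (fun p : vertex quiver22 * seq (arrow quiver22) => is_path p.1 p.2)
    (inl a.1, [:: a]) (introT andP (conj (eqxx _) isT)).

(** Targets are sinks and sources are not, so no two arrows compose. *)
Lemma path_case (p : qpath quiver22) :
  (exists v, p = trivial_path v) \/ (exists a, p = arrow_path a).
Proof.
case: p => [[v [|a [|b s]]] /= h].
- by left; exists v; apply: val_inj.
- right; exists a; apply: val_inj => /=; by case/andP: h => /eqP <-.
- by exfalso; move: h; rewrite andbF.
Qed.

Lemma path_ends_inj (p q : qpath quiver22) :
  path_start p = path_start q -> path_end p = path_end q -> p = q.
Proof.
case: (path_case p) => [[v ->]|[a ->]]; case: (path_case q) => [[v' ->]|[a' ->]].
- by rewrite /path_start /= => ->.
- by rewrite /path_start /path_end /= => ->.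
- by rewrite /path_start /path_end /= => <-.
rewrite /path_start /path_end /= => -[e1] [e2]; congr arrow_path.
by case: a a' e1 e2 => [? ?] [? ?] /= -> ->.
Qed.

(** Concatenation is read from left to right, so the row is the start and the column the end. Thus
    p_1, p_2 sit at positions 0, 1, which are the targets for the action on columns. *)
Definition path_elt (p : qpath quiver22) : subvs_of B4 :=
  vsproj B4 (delta_mx (vertex_index (path_start p)) (vertex_index (path_end p))).

Lemma path_eltE p :
  vsval (path_elt p) = delta_mx (vertex_index (path_start p)) (vertex_index (path_end p)).
Proof.
rewrite vsprojK //; apply: delta_im4.
case: (path_case p) => [[v ->]|[[a b] ->]]; first by rewrite eqxx.
by rewrite /arrow4 /= ltn_ord orbT.
Qed.

Lemma vertex_index_surj i : exists s, i = vertex_index s.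
Proof. by exists (@split 2 2 i); rewrite /vertex_index splitK. Qed.

Lemma path_exists s t : (s == t) || arrow4 (vertex_index s) (vertex_index t) ->
  exists p : qpath quiver22, path_start p = s /\ path_end p = t.
Proof.
case: eqP => [<- _|_]; first by exists (trivial_path s).
case: s t => [i|i] [j|j] /andP[] /=.
- by move=> _; rewrite ltnNge -ltnS ltn_ord.
- by move=> _ _; exists (arrow_path (i, j)).
- by rewrite ltnNge leq_addr.
by rewrite ltnNge leq_addr.
Qed.

Definition all_paths : seq (qpath quiver22) :=
  [seq trivial_path v | v : vertex quiver22] ++ [seq arrow_path a | a : arrow quiver22].

Lemma all_paths_uniq : uniq all_paths.
Proof.
rewrite cat_uniq !map_inj_uniq //.
- rewrite -!enumT !enum_uniq andbT /=.
  apply/hasPn => _ /mapP[a _ ->]; apply/mapP => -[v _].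
  by move=> /(congr1 val).
- by move=> a b /(congr1 val) [].
- by move=> a b /(congr1 val) [].
Qed.

Lemma mem_all_paths p : p \in all_paths.
Proof.
by case: (path_case p) => -[x ->]; rewrite mem_cat !map_f ?mem_enum ?orbT.
Qed.

(** There are no parallel paths, so distinct paths give distinct matrix units and coefficients are
    matrix entries; spanning and independence both follow. *)
Lemma path_elt_coef (s : seq (qpath quiver22)) (c : qpath quiver22 -> K) p :
  uniq s -> p \in s ->
  vsval (\sum_(q <- s) c q *: path_elt q)
    (vertex_index (path_start p)) (vertex_index (path_end p)) = c p.
Proof.
move=> s_uniq ps; rewrite linear_sum summxE (bigD1_seq p) //= big1 ?addr0.
  by rewrite !mxE path_eltE !mxE !eqxx mulr1.
move=> q qp; rewrite !mxE path_eltE !mxE !(inj_eq vertex_index_inj).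
case: eqP => [e1|]; last by rewrite mulr0.
case: eqP => [e2|]; last by rewrite mulr0.
by case/eqP: qp; apply: path_ends_inj.
Qed.

Lemma path_algebra_B4 : is_path_algebra quiver22 (subvs_of B4).
Proof.
exists path_elt; split.
- move=> x; exists all_paths.
  exists (fun p => vsval x (vertex_index (path_start p)) (vertex_index (path_end p))).
  set y := \sum_(p <- _) _; apply: val_inj; apply/matrixP => i j.
  have [[s ->] [t ->]] := (vertex_index_surj i, vertex_index_surj j).
  case h : ((s == t) || arrow4 (vertex_index s) (vertex_index t)).
    have [p [<- <-]] := path_exists h.
    by rewrite /y /= path_elt_coef ?all_paths_uniq ?mem_all_paths.
  move/negbT: h; rewrite negb_or -(inj_eq vertex_index_inj) => /andP[st ar].
  by rewrite !(im4_zero (subvsP _) st ar).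
- by move=> s c s_uniq s0 p ps; rewrite -(path_elt_coef c s_uniq ps) s0 mxE.
- move=> p q r [pq rE]; apply: val_inj; rewrite /= !path_eltE -mulmxE pq mul_delta_mx.
  by rewrite /path_start /path_end rE /= map_cat last_cat -/(path_end p) pq.
- move=> p q pq; apply: val_inj; rewrite /= !path_eltE -mulmxE mul_delta_mx_0 //.
  by apply/eqP => /vertex_index_inj.
apply: val_inj; rewrite [LHS](_ : _ = 1%:M); last first.
  by apply/eqP; rewrite (algid_eq1 B4); apply: im4_one.
apply/matrixP => i j; rewrite linear_sum summxE mxE.
have [[s ->] [t ->]] := (vertex_index_surj i, vertex_index_surj j).
rewrite (bigD1 s) //= big1 ?addr0 => [|v vs]; rewrite path_eltE mxE !(inj_eq vertex_index_inj).
  by rewrite eqxx eq_sym.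
by rewrite eq_sym (negPf vs).
Qed.

Lemma path_quotient : exists (I : SA -> Prop) (B : algType K),
  [/\ two_sided_ideal I, is_path_algebra quiver22 B & quotient_iso I B].
Proof.
exists (fun x => toB x = 0), (subvs_of B4); split; first split.
- exact: linear0.
- by move=> x y hx hy; rewrite linearD /= hx hy addr0.
- by move=> a x hx; rewrite !rmorphM /= hx mulr0 mul0r.
- exact: path_algebra_B4.
exists toB; split=> // y.
have /im4P[x e] := subvsP y; exists x; apply: val_inj; by rewrite /= toBK e.
Qed.

End PathQuotient.

(** * The root of unity [omega] and the conclusion *)

Lemma omega_exp (R : realType) (N k : nat) :
  omega R N ^+ k = (cos (2 * pi / N%:R *+ k) +i* sin (2 * pi / N%:R *+ k))%C.
Proof.
elim: k => [|k IH]; first by rewrite expr0 mulr0n cos0 sin0.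
rewrite exprSr IH [in RHS](mulrSr (2 * pi / N%:R)) cosD sinD /omega.
by rewrite [sin _ * _ + _]addrC.
Qed.

(** If the order [m] were less than [N], the angle pi m / N would lie strictly between 0 and pi, so
    its sine would be positive, while the cosine of its double being 1 makes the sine vanish. *)
Lemma omega_prim (R : realType) (N : nat) : (0 < N)%N -> N.-primitive_root (omega R N).
Proof.
move=> N0; have NR : N%:R != 0 :> R by rewrite pnatr_eq0; lia.
have oN : omega R N ^+ N = 1.
  rewrite omega_exp (_ : 2 * pi / N%:R *+ N = pi *+ 2).
    by rewrite cos2pi sin2pi.
  by rewrite -mulr_natr mulfVK // mulr_natl.
have [m hm mN] := prim_order_exists N0 oN.
have m0 := prim_order_gt0 hm.
case: (ltngtP m N) => [lt|gt|e]; last by rewrite -{1}e.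
  have := prim_expr_order hm; rewrite omega_exp => /eqP.
  rewrite eq_complex /= => /andP[/eqP hc _].
  have : 0 < sin (pi / N%:R *+ m : R).
    apply: sin_gt0_pi; apply/andP; split.
      by rewrite pmulrn_lgt0 // divr_gt0 ?pi_gt0 // ltr0n.
    rewrite -mulr_natr mulrAC ltr_pdivrMr ?ltr0n // ltr_pM2l ?pi_gt0 //.
    by rewrite ltr_nat.
  have : 2 * pi / N%:R *+ m = (pi / N%:R *+ m) *+ 2 :> R.
    by rewrite -mulrA mulr_natl mulrnAC.
  move=> e; rewrite e cos_mulr2n in hc.
  have h2 := cos2Dsin2 (pi / N%:R *+ m : R).
  move=> hs; have : sin (pi / N%:R *+ m : R) ^+ 2 = 0 by lra.
  by move/eqP; rewrite sqrf_eq0 => /eqP h; rewrite h ltxx in hs.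
by have := dvdn_leq N0 mN; rewrite leqNgt gt.
Qed.

Lemma idem_idem_mx (R : realType) (N : nat) (a : 'Z_N) : idem R a = idem_mx (omega R N) a.
Proof. reflexivity. Qed.

Theorem corollary6p3 (R : realType) (n N : nat) (u : R[i])
    (hN : N = (2 * n)%N) (hN4 : (4 <= N)%N) (hu0 : u != 0) (huN : u ^+ N != 1) :
  [/\ 'Z(algA N u)%VS = 1%VS
    , forall a b : 'Z_N,
        cartan u a b
          = if (a == b) || (level a != level b) then 1%N else 0%N
    , \rank (cartan_mx N u) = (N - 1)%N
      /\ (forall v : 'cV[R[i]]_(Zp_trunc N).+2,
            cartan_mx N u *m v = 0 <->
            exists c : R[i],
              v = c *: (delta_mx (0 : 'Z_N) 0 - delta_mx (n%:R : 'Z_N) 0))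
    , gldim_infinite (subvs_of (algA N u))
      /\ infinite_rep_type (subvs_of (algA N u))
    & exists (I : subvs_of (algA N u) -> Prop) (B : algType R[i]),
        [/\ two_sided_ideal I, is_path_algebra quiver22 B
          & quotient_iso I B]].
Proof.
have w_prim : N.-primitive_root (omega R N) by apply: omega_prim; lia.
(* [opT] and [opLambda] unfold to [T_mx] and [Lambda_mx] at [w = omega R N]. *)
have AE : algA N u = algTL N (omega R N) u by reflexivity.
have cartanE (a b : 'Z_N) : cartan u a b = linked a b.
  by rewrite /cartan !idem_idem_mx AE (dim_corner hN hN4 w_prim hu0 huN).
have cartan_mxE : cartan_mx N u = linked_mx _ N.
  by apply/matrixP => a b; rewrite !mxE cartanE.
split.
- by rewrite AE; apply: (center_algTL hN hN4 w_prim hu0 huN).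
- by move=> a b; rewrite cartanE -/(linked a b); case: (linked a b).
- rewrite cartan_mxE; split; first exact: (linked_mx_rank _ hN hN4).
  by move=> v; apply: linked_mx_ker.
- rewrite AE; split; first exact: (gldim_algTL hN hN4 w_prim hu0 huN).
  apply: (infinite_rep_algTL hN hN4 w_prim hu0 huN).
  by move=> i j /eqP; rewrite eqr_nat => /eqP.
rewrite AE; exact: (path_quotient hN hN4 w_prim hu0 huN).
Qed.
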